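(* Let $q\ge3$ be an integer and let $a,b>0$ be constants with $2(a+b)>1$. Let $R=\left\lfloor \frac{1}{10\log(2(a+b))}\log n\right\rfloor$. For any fixed vertex $v\in G$, there is a coupling between $(G,\sigma')$ and $(T,\sigma)$ such that $(B(v,R),\sigma'_{B(v,R)})=(T_R,\sigma_R)$ asymptotically almost surely (i.e. with probability tending to $1$ as $n\to\infty$), where equality means isomorphism of rooted labelled graphs.
   Context: $(G,\sigma')$ is the sparse stochastic block model on $n$ vertices with $q$ communities: the labels $\sigma'_u\in[q]$ are independent and uniform, and given $\sigma'$ each pair of vertices $u,w$ is joined by an edge independently with probability $a/n$ if $\sigma'_u=\sigma'_w$ and $b/n$ otherwise. $B(v,R)$ is the ball of radius $R$ around $v$ in graph distance (the induced subgraph, rooted at $v$), and $\sigma'_{B(v,R)}$ is the restriction of $\sigma'$ to it. $(T,\sigma)$ is the labelled Galton-Watson tree with root $\rho$ in which $\sigma_\rho$ is uniform on $[q]$ and each vertex $u$ independently has $\mathrm{Pois}(a/q)$ children with label $\sigma_u$ and, for each $i\ne\sigma_u$, independently $\mathrm{Pois}(b/q)$ children with label $i$. (Equivalently, each vertex has $\mathrm{Pois}(d)$ children with $d=\frac{a+(q-1)b}{q}$, and each child keeps its parent's label with probability $1-p=\frac{a}{a+(q-1)b}$ and otherwise takes a uniformly random different label.) $T_R$ is the restriction of $T$ to its first $R$ levels (levels $0,\dots,R$) and $\sigma_R$ the restriction of $\sigma$ to $T_R$. *)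

(* Defs.v *)
From HB Require Import structures.
From mathcomp Require Import all_boot all_order all_algebra.
From mathcomp Require Import all_classical all_reals all_analysis.

Set Implicit Arguments.
Unset Strict Implicit.
Unset Printing Implicit Defensive.

Import Order.TTheory GRing.Theory Num.Theory.
Import numFieldNormedType.Exports.

Local Open Scope classical_set_scope.
Local Open Scope ring_scope.

(* The vertices are the elements of [rl_vset] only; [rl_adj] and [rl_lab] are
   irrelevant outside of it, so shrinking [rl_vset] gives induced subgraphs. *)
Record rlgraph (L : Type) := RLGraph {
  rl_vertex : eqType;
  rl_vset : set rl_vertex;
  rl_adj : rel rl_vertex;
  rl_root : rl_vertex;
  rl_lab : rl_vertex -> L }.
Arguments rl_vset {L} _.
Arguments rl_adj {L} _.
Arguments rl_root {L} _.
Arguments rl_lab {L} _.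

Definition rl_isom (L : Type) (X Y : rlgraph L) : Prop :=
  exists f : rl_vertex X -> rl_vertex Y,
    [/\ set_bij (rl_vset X) (rl_vset Y) f,
        f (rl_root X) = rl_root Y,
        forall u w, rl_vset X u -> rl_vset X w ->
          rl_adj Y (f u) (f w) = rl_adj X u w
      & forall u, rl_vset X u -> rl_lab Y (f u) = rl_lab X u].

Definition simple_rel (n : nat) (e : {ffun 'I_n * 'I_n -> bool}) : bool :=
  [forall i, ~~ e (i, i)] && [forall i, forall j, e (i, j) == e (j, i)].

Definition sgraph (n : nat) := {e : {ffun 'I_n * 'I_n -> bool} | simple_rel e}.

Definition sg_adj (n : nat) (g : sgraph n) : rel 'I_n :=
  fun i j => val g (i, j).

Definition dist_le (n : nat) (g : sgraph n) (v u : 'I_n) (r : nat) : Prop :=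
  exists p : seq 'I_n,
    [/\ path (sg_adj g) v p, last v p = u & (size p <= r)%N].

Definition sg_ball (n q : nat) (g : sgraph n) (s : {ffun 'I_n -> 'I_q})
    (v : 'I_n) (r : nat) : rlgraph 'I_q :=
  {| rl_vertex := 'I_n;
     rl_vset := [set u | dist_le g v u r];
     rl_adj := sg_adj g;
     rl_root := v;
     rl_lab := s |}.

(* The minimum with 1 only matters for the finitely many n < max(a, b). *)
Definition sbm_edge_prob (R : realType) (n : nat) (a b : R) (same : bool) : R :=
  Num.min 1 ((if same then a else b) / n%:R).

Definition sbm_pmf (R : realType) (n q : nat) (a b : R)
    (g : sgraph n) (s : {ffun 'I_n -> 'I_q}) : R :=
  (q%:R^-1) ^+ n *
  \prod_(i < n) \prod_(j < n | (i < j)%N)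
    let p := sbm_edge_prob n a b (s i == s j) in
    if sg_adj g i j then p else 1 - p.

(* Ulam-Harris-Neveu words: the letter (i, k) goes to the k-th child with
   label i, so the label of a vertex other than the root is the first component
   of its last letter. *)
Definition word (q : nat) := seq ('I_q * nat).

(* A labelled tree is given by the label of its root and the number
   [lt_offspring u i] of children with label i of each word u.  These numbers
   have no effect at the words u that are not vertices of the tree. *)
Record ltree (q : nat) := LTree {
  lt_root_label : 'I_q;
  lt_offspring : word q -> 'I_q -> nat }.

Definition word_label (q : nat) (s : 'I_q) (u : word q) : 'I_q :=
  last s (map fst u).

Definition in_ltree (q : nat) (t : ltree q) (w : word q) : Prop :=
  forall u c u', w = u ++ c :: u' -> (c.2 < lt_offspring t u c.1)%N.

Definition is_child (q : nat) (u w : word q) : bool :=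
  prefix u w && (size w == (size u).+1).

Definition ltree_trunc (q : nat) (t : ltree q) (r : nat) : rlgraph 'I_q :=
  {| rl_vertex := word q;
     rl_vset := [set w | in_ltree t w /\ (size w <= r)%N];
     rl_adj := fun u w => is_child u w || is_child w u;
     rl_root := [::];
     rl_lab := word_label (lt_root_label t) |}.

Definition offspring_rate (R : realType) (q : nat) (a b : R) (i j : 'I_q) : R :=
  (if i == j then a else b) / q%:R.

Section Laws.
Context {R : realType} {d : measure_display} {Omega : measurableType d}.
Variable P : probability Omega R.

Definition is_sbm (n q : nat) (a b : R)
    (G : Omega -> sgraph n) (S : Omega -> {ffun 'I_n -> 'I_q}) : Prop :=
  forall g s,
    measurable [set x | G x = g /\ S x = s] /\
    P [set x | G x = g /\ S x = s] = (sbm_pmf a b g s)%:E.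

(* The law is specified by its finite-dimensional distributions: the root
   label is uniform and, given that it equals s, the offspring numbers
   [lt_offspring u i] are independent Poisson variables, whose rates depend on
   s only through the label of the root. *)
Definition is_gw (q : nat) (a b : R) (T : Omega -> ltree q) : Prop :=
  [/\ forall s, measurable [set x | lt_root_label (T x) = s],
      forall u i k, measurable [set x | lt_offspring (T x) u i = k]
    & forall (s : 'I_q) (F : seq (word q * 'I_q)) (k : word q -> 'I_q -> nat),
        uniq F ->
        P [set x | lt_root_label (T x) = s /\
             forall u i, (u, i) \in F -> lt_offspring (T x) u i = k u i] =
        (q%:R^-1 * \prod_(c <- F)
           poisson_pmf (offspring_rate a b (word_label s c.1) c.2)
                       (k c.1 c.2))%:E].

End Laws.

Record sbm_gw_coupling (R : realType) (n q : nat) (a b : R) := SbmGwCoupling {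
  cpl_disp : measure_display;
  cpl_space : measurableType cpl_disp;
  cpl_prob : probability cpl_space R;
  cpl_graph : cpl_space -> sgraph n;
  cpl_labels : cpl_space -> {ffun 'I_n -> 'I_q};
  cpl_tree : cpl_space -> ltree q;
  cpl_sbm : is_sbm cpl_prob a b cpl_graph cpl_labels;
  cpl_gw : is_gw cpl_prob a b cpl_tree }.
Arguments cpl_prob {R n q a b} C : rename.

(* This event is measurable: it depends on countably many discrete variables,
   all measurable by [is_sbm] and [is_gw]. *)
Definition ball_eq_tree (R : realType) (n q : nat) (a b : R)
    (C : sbm_gw_coupling n q a b) (v : 'I_n) (r : nat) : set (cpl_space C) :=
  [set x | rl_isom (sg_ball (cpl_graph x) (cpl_labels x) v r)
                   (ltree_trunc (cpl_tree x) r)].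
Arguments ball_eq_tree {R n q a b} C v r.

(* [Num.truncn] is the floor here: its argument is nonnegative when
   1 < 2 * (a + b) and 0 < n. *)
Definition ball_radius (R : realType) (a b : R) (n : nat) : nat :=
  Num.truncn (1 / (10 * ln (2 * (a + b))) * ln n%:R).

(* Main.v *)
Require Import Defs.
From HB Require Import structures.
From mathcomp Require Import all_boot all_order all_algebra.
From mathcomp Require Import all_classical all_reals all_analysis.
From mathcomp Require Import measurable_realfun ring lra zify.

Set Implicit Arguments.
Unset Strict Implicit.
Unset Printing Implicit Defensive.

Import Order.TTheory GRing.Theory Num.Theory.
Import numFieldNormedType.Exports.

Local Open Scope classical_set_scope.
Local Open Scope ring_scope.

(** Fix a labelled tree t of depth r with m vertices, and let c range over its
    blocks: pairs of a vertex of depth less than r and a label.  A block has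
    k_c children, with rate lambda_c.  The truncated Galton-Watson tree equals
    t with probability
      nu(t) = 1/q * prod_c exp(- lambda_c) * lambda_c ^ k_c / k_c!.
    The ball of radius r around v is t, placed along a given injection of the
    vertices of t into the n vertices of the graph, as soon as the labels agree,
    the m - 1 tree edges are present, the other pairs of placed vertices are not
    edges, and no vertex of depth less than r has an edge to a vertex that is
    not placed.  Each tree edge has probability q * lambda_c / n, which
    together with the probability q ^ (- m) of the labels produces the factor
    1/q * prod_c lambda_c ^ k_c / n ^ (m - 1); the missing edges to the outside cost (1 - d i / n) ^ n, close to exp (- d i), where i is
    the number of vertices of depth less than r and d the mean offspring; the
    missing edges inside cost 1 - O(m ^ 2 / n).  A ball is counted once if the
    children of every block are placed in increasing order, and there are
    (n - 1) (n - 2) ... (n - m + 1) / prod_c k_c! such placements.  Altogether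
    the ball is t with probability at least (1 - O(m ^ 2 / n)) nu(t): this is
    [likelihood], from [emb_prob] for one placement and [size_draws] for their
    number.

    A lower bound is enough.  Both laws have total mass 1, so the graph and the
    tree can be coupled in such a way that the ball is isomorphic to the tree
    with probability at least (1 - O(M ^ 2 / n)) times the probability that the
    tree has at most M vertices ([ball_tree_coupling]).  The graph takes
    finitely many values, so [finite_coupling] only has to fill a finite table of
    joint masses; the graph is then drawn, given the class of the tree, with an
    independent uniform variable ([coupling_lift]).  The tree is built from
    one uniform variable by nested intervals ([draw_cond], [gw_tree_is_gw]).

    With D = 2 (a + b), the choice of the radius gives (D ^ r) ^ 10 <= n, and
    the expected number of vertices of the tree is at most
    sum_(j <= r) (a + b) ^ j <= 2 D ^ r ([size_verts_tail],
    [geometric_bound]).  For M = (D ^ r) ^ 3 the tree is larger than M with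
    probability at most 2 / D ^ (2 r), while M ^ 2 / n <= 1 / D ^ (4 r); both
    tend to 0 since r tends to infinity. *)

(** * Dependent discrete draws on the unit interval *)

Lemma measurable_bigcup_countType (d : measure_display) (T : measurableType d) (I : countType)
    (D : set I) (F : I -> set T) :
  (forall i, measurable (F i)) -> measurable (\bigcup_(i in D) F i).
Proof.
move=> mF; rewrite bigcup_mkcond; apply: countable_bigcupT_measurable => //.
by move=> i; case: ifP.
Qed.

Lemma probability_bigcup_finType (d : measure_display) (T : measurableType d)
    (R : realType) (mu : probability T R) (I : finType) (F : I -> set T) :
  (forall i, measurable (F i)) -> trivIset setT F ->
  mu (\bigcup_i F i) = (\sum_i mu (F i))%E.
Proof.
move=> mF tF; have E : [set: I] = [set` index_enum I].
  by apply/seteqP; split => i //= _; rewrite mem_index_enum.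
rewrite E in tF *; rewrite measure_fin_bigcup //.
by rewrite -fsbig_seq // index_enum_uniq.
Qed.

Section Sequences.
Context {R : realType}.
Variable p : seq nat -> nat -> R.
Hypothesis p_ge0 : forall h k, 0 <= p h k.
Hypothesis p_sum : forall h, series (p h) @ \oo --> (1 : R).

Fixpoint cyl_len (h : seq nat) : R :=
  if h is k :: h' then cyl_len h' * p h' k else 1.

(** Histories are stored with the latest draw first.  The interval of a history h
    is cut into consecutive intervals of lengths proportional to the masses
    p h k; these are the intervals of the histories k :: h. *)
Fixpoint cyl_lo (h : seq nat) : R :=
  if h is k :: h' then cyl_lo h' + cyl_len h' * series (p h') k else 0.

Definition cyl h : set R := `[cyl_lo h, cyl_lo h + cyl_len h[.

(** A point of [0, 1) determines its history as the one whose interval contains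
    it.  Outside of [0, 1) no interval qualifies and [xget] returns 0. *)
Fixpoint hist (x : R) (n : nat) : seq nat :=
  if n is n'.+1 then
    xget 0%N [set k | cyl (k :: hist x n') x] :: hist x n'
  else [::].

Definition draw x n := head 0%N (hist x n.+1).

Definition unif01 : probability (measurableTypeR R) R := uniform_prob (@ltr01 R).

Lemma size_hist x n : size (hist x n) = n.
Proof. by elim: n => //= n ->. Qed.

Lemma histS x n : hist x n.+1 = draw x n :: hist x n.
Proof. by []. Qed.

Lemma cyl_len_ge0 h : 0 <= cyl_len h.
Proof. by elim: h => //= k h IH; rewrite mulr_ge0. Qed.

Lemma cdf_series_ge0 h k : 0 <= series (p h) k.
Proof. by apply: sumr_ge0 => i _. Qed.

Lemma cdf_series_nd h : nondecreasing_seq (series (p h)).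
Proof.
by apply: nondecreasing_series => i _ _; exact: p_ge0.
Qed.

Lemma cdf_series_le1 h k : series (p h) k <= 1.
Proof.
rewrite -(cvg_lim _ (p_sum h)) //.
by apply: (nondecreasing_cvgn_le (@cdf_series_nd h)); apply/cvg_ex; exists 1; exact: p_sum.
Qed.

Lemma cyl_sub k h : cyl (k :: h) `<=` cyl h.
Proof.
move=> x; rewrite /cyl /= !in_itv /= => /andP[h1 h2]; apply/andP; split.
  by apply: le_trans h1; rewrite lerDl mulr_ge0 ?cyl_len_ge0 ?cdf_series_ge0.
apply: (lt_le_trans h2); rewrite -addrA lerD2l -mulrDr.
rewrite ler_piMr ?cyl_len_ge0 // -seriesSr.
exact: cdf_series_le1.
Qed.

Lemma cyl_inj k k' h x : cyl (k :: h) x -> cyl (k' :: h) x -> k = k'.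
Proof.
wlog kk : k k' / (k <= k')%N.
  by move=> H a b; case/orP: (leq_total k k') => kk; [|symmetry]; exact: H kk _ _.
rewrite /cyl /= !in_itv /= => /andP[_ h2] /andP[h1 _].
move: kk; rewrite leq_eqVlt => /orP[/eqP//|kk]; exfalso.
have := le_lt_trans h1 h2; rewrite -addrA ltrD2l -mulrDr -seriesSr.
by rewrite ltNge ler_wpM2l ?cyl_len_ge0 // cdf_series_nd.
Qed.

Lemma cyl_ex h x : cyl h x -> exists k, cyl (k :: h) x.
Proof.
rewrite {1}/cyl /= in_itv /= => /andP[h1 h2].
have l0 : 0 < cyl_len h by rewrite -(ltrD2l (cyl_lo h)) addr0 (le_lt_trans h1).
have [n hn] : exists n, x < cyl_lo h + cyl_len h * series (p h) n.
  have H : (x - cyl_lo h) / cyl_len h < 1 by rewrite ltr_pdivrMr // mul1r ltrBlDl.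
  have := cvgr_gt _ (p_sum h) _ H => -[n _ /(_ n (leqnn n)) /= Hn].
  by exists n; rewrite -ltrBlDl mulrC -ltr_pdivrMr.
have := @ex_minnP _ (ex_intro (fun n => x < cyl_lo h + cyl_len h * series (p h) n) n hn).
case=> -[|m] hm hmin.
  by move: hm; rewrite seriesEnat /= big_geq // mulr0 addr0 ltNge h1.
exists m; rewrite /cyl /= in_itv /=; apply/andP; split.
  by rewrite leNgt; apply/negP => /hmin; rewrite ltnn.
by rewrite -addrA -mulrDr -seriesSr.
Qed.

Lemma cyl_hist x n : cyl [::] x -> cyl (hist x n) x.
Proof.
move=> x0; elim: n => // n /cyl_ex[k hk].
by rewrite [hist _ _]/=; case: xgetP => [j -> //|/(_ k)].
Qed.

Lemma hist_cyl h x : cyl h x -> hist x (size h) = h.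
Proof.
elim: h => //= k h IH hx; have := IH (cyl_sub hx) => ->; congr cons.
case: xgetP => [j _ /= hj|/(_ k)//]; exact: cyl_inj hj hx.
Qed.

Lemma cyl_sub0 h : cyl h `<=` cyl [::].
Proof. by elim: h => // k h IH x /cyl_sub/IH. Qed.

Lemma hist_out x n : ~ cyl [::] x -> hist x n = nseq n 0%N.
Proof.
move=> x0; elim: n => //= n ->; congr cons; case: xgetP => // j _ /= hj.
by case: x0; exact: cyl_sub0 hj.
Qed.

Lemma measurable_cyl h : measurable (cyl h).
Proof. exact: measurable_itv. Qed.

Lemma unif01_itv (x y : R) : 0 <= x -> x <= y -> y <= 1 ->
  unif01 `[x, y[%classic = (y - x)%:E.
Proof.
move=> x0 xy y1; rewrite /unif01 /= /uniform_prob integral_uniform_pdf.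
rewrite setIidl; last first.
  move=> z; rewrite /= !in_itv /= => /andP[h1 h2].
  by rewrite (le_trans x0 h1) (le_trans (ltW h2) y1).
rewrite (eq_integral (fun=> 1%E)); last first.
  move=> z; rewrite inE /= in_itv /= => /andP[h1 h2].
  by rewrite /uniform_pdf (le_trans x0 h1) (le_trans (ltW h2) y1) subr0 invr1.
rewrite integral_cst //= mul1e lebesgue_measure_itv /= lte_fin.
case: ltP => [//|yx]; congr EFin; apply/esym/eqP; rewrite subr_eq0.
by rewrite eq_le yx xy.
Qed.

Lemma unif01_cyl h : unif01 (cyl h) = (cyl_len h)%:E.
Proof.
have H : 0 <= cyl_lo h /\ cyl_lo h + cyl_len h <= 1.
  elim: h => [|k h [IH1 IH2]] /=; first by rewrite add0r.
  split; first by rewrite addr_ge0 // mulr_ge0 ?cyl_len_ge0 ?cdf_series_ge0.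
  apply: le_trans IH2; rewrite -addrA -mulrDr lerD2l -seriesSr.
  by rewrite ler_piMr ?cyl_len_ge0 ?cdf_series_le1.
case: H => H1 H2; rewrite /cyl unif01_itv //; last by rewrite lerDl cyl_len_ge0.
by congr EFin; rewrite addrAC subrr add0r.
Qed.

Lemma unif01_cylC : unif01 (~` cyl [::]) = 0%E.
Proof.
rewrite probability_setC; last exact: measurable_cyl.
by rewrite unif01_cyl /= subee.
Qed.

Lemma hist_setE n h : [set x | hist x n = h] `&` cyl [::] =
  if size h == n then cyl h else set0.
Proof.
apply/seteqP; split => x /=.
  by move=> [<- x0]; rewrite size_hist eqxx; exact: cyl_hist.
case: ifPn => // /eqP <- hx; split; first exact: hist_cyl.
exact: cyl_sub0 hx.
Qed.

Lemma measurable_hist1 n h : measurable [set x | hist x n = h].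
Proof.
rewrite -(setIT [set x | _]) -(setUv (cyl [::])) setIUr.
apply: measurableU.
  by rewrite hist_setE; case: ifP => _ //; exact: measurable_cyl.
have -> : [set x | hist x n = h] `&` ~` cyl [::] =
   if h == nseq n 0%N then ~` cyl [::] else set0.
  apply/seteqP; split => x /=.
    by move=> [<- x0]; rewrite (hist_out n x0) eqxx.
  by case: ifPn => [/eqP hh|] // hx; split => //; rewrite hh; exact: hist_out.
by case: ifP => _ //; apply: measurableC; exact: measurable_cyl.
Qed.

Lemma measurable_hist n (E : set (seq nat)) : measurable [set x | E (hist x n)].
Proof.
have -> : [set x | E (hist x n)] = \bigcup_(h in E) [set x | hist x n = h].
  by apply/seteqP; split => x /=; [move=> Ex; exists (hist x n) | move=> [h Eh ->]].
by apply: measurable_bigcup_countType => h; exact: measurable_hist1.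
Qed.

(** The chain rule: a draw whose conditional mass at k is the same constant c for
    all histories of an event is independent of that event.  The event is cut
    along its countably many histories, and each interval contributes the factor
    c. *)
Lemma draw_cond n (E : set (seq nat)) k c :
  (forall h, E h -> size h = n -> p h k = c) ->
  unif01 [set x | E (hist x n) /\ draw x n = k] =
  (c%:E * unif01 [set x | E (hist x n)])%E.
Proof.
move=> Ec.
have mE := measurable_hist n E.
have mEk : measurable [set x | E (hist x n) /\ draw x n = k].
  exact: (measurable_hist n.+1 [set h | E (behead h) /\ head 0%N h = k]).
have m0 : measurable (cyl [::]) := measurable_cyl [::].
have mC : measurable (~` cyl [::]) := measurableC m0.
(* Points outside of [0, 1) lie in none of the intervals, so they are discarded
   before the event is cut into intervals. *)
have restr (B : set (measurableTypeR R)) : measurable B ->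
    unif01 B = unif01 (B `&` cyl [::]).
  move=> mB; rewrite -[in LHS](setIT B) -(setUv (cyl [::])) setIUr measureU.
  - rewrite [X in (_ + X)%E](_ : _ = 0%E) ?adde0 //.
    apply/eqP; rewrite -measure_le0 -unif01_cylC.
    apply: le_measure; [rewrite inE; exact: measurableI|by rewrite inE|].
    exact: subIsetr.
  - exact: measurableI.
  - exact: measurableI.
  - by rewrite setIACA setICr setI0.
rewrite restr // [in RHS]restr //.
pose D (h : seq nat) := `[< E h >] && (size h == n).
pose F i := if pickle_inv i is Some h then if D h then cyl h else set0 else set0.
pose G i := if pickle_inv i is Some h then if D h then cyl (k :: h) else set0
            else set0.
have DE h x : D h -> cyl h x -> E (hist x n) /\ hist x n = h.
  by case/andP => /asboolP Eh /eqP <- hx; rewrite (hist_cyl hx).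
have eF : [set x | E (hist x n)] `&` cyl [::] = \bigcup_i F i.
  apply/seteqP; split => x /=.
    move=> [Ex x0]; exists (pickle (hist x n)) => //; rewrite /F pickleK_inv.
    by rewrite /D size_hist eqxx andbT asboolT //; exact: cyl_hist.
  move=> [i _]; rewrite /F; case: pickle_inv => // h; case: ifPn => // Dh hx.
  by split; [case: (DE _ _ Dh hx)|exact: cyl_sub0 hx].
have eG : [set x | E (hist x n) /\ draw x n = k] `&` cyl [::] = \bigcup_i G i.
  apply/seteqP; split => x /=.
    move=> [[Ex xk] x0]; exists (pickle (hist x n)) => //; rewrite /G pickleK_inv.
    rewrite /D size_hist eqxx andbT asboolT //.
    by have := cyl_hist n.+1 x0; rewrite histS xk.
  move=> [i _]; rewrite /G; case: pickle_inv => // h; case: ifPn => // Dh hx.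
  have [E1 E2] := DE _ _ Dh (cyl_sub hx).
  split; last exact: cyl_sub0 hx; split => //.
  have := hist_cyl hx; rewrite /= => -[]; case/andP: Dh => _ /eqP ->.
  by [].
have mF i : measurable (F i).
  by rewrite /F; case: pickle_inv => // h; case: ifP => // _; exact: measurable_cyl.
have mG i : measurable (G i).
  by rewrite /G; case: pickle_inv => // h; case: ifP => // _; exact: measurable_cyl.
have FG i : G i `<=` F i.
  by rewrite /F /G; case: pickle_inv => // h; case: (D h) => // x; exact: cyl_sub.
have tF : trivIset setT F.
  have Fi i x : F i x -> i = pickle (hist x n).
    rewrite /F; have := @pickle_invK (seq nat) i.
    case: pickle_inv => //= h <-; case: ifPn => // Dh hx.
    by have [_ ->] := DE _ _ Dh hx.
  by move=> i j _ _ [x [/Fi -> /Fi ->]].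
have tG : trivIset setT G.
  by move=> i j _ _ [x [/FG Fi /FG Fj]]; apply: (tF i j) => //; exists x.
rewrite eF eG !measure_bigcup //.
rewrite -nneseriesZl //.
apply: eq_eseriesr => i _; rewrite /F /G; case: pickle_inv => [h|].
  case: (boolP (D h)) => [/andP[/asboolP Eh /eqP sh]|_]; last first.
    by rewrite measure0 mule0.
  by rewrite /= !unif01_cyl /= -EFinM mulrC (Ec _ Eh sh).
by rewrite measure0 mule0.
  by move=> i _; exact: mF.
by move=> i _; exact: mG.
Qed.

End Sequences.

Arguments draw : simpl never.

Section ReadingHistories.
Context {R : realType}.
Variable p : seq nat -> nat -> R.
Hypothesis p_ge0 : forall h k, 0 <= p h k.
Hypothesis p_sum : forall h, series (p h) @ \oo --> (1 : R).

Lemma nth_hist x n j : (j < n)%N -> nth 0%N (hist p x n) (n - j.+1) = draw p x j.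
Proof.
elim: n => // n IH; rewrite ltnS leq_eqVlt => /orP[/eqP ->|jn].
  by rewrite subnn.
by rewrite subSS histS -(IH jn) -(subnSK jn).
Qed.

Lemma last_hist x n : last 0%N (hist p x n.+1) = draw p x 0.
Proof.
by elim: n => // n <-.
Qed.

(** A value of mass 0 has an empty interval, so it is never drawn inside [0, 1),
    and outside all draws are 0.  Hence a draw from a finite range stays in
    range at every point, with no null set to discard. *)
Lemma draw_supp x n : p (hist p x n) (draw p x n) = 0 -> draw p x n = 0%N.
Proof.
move=> p0; have [x0|x0] := pselect (cyl p [::] x); last first.
  by have := hist_out p_ge0 p_sum n.+1 x0; rewrite histS /= => -[].
have := cyl_hist p_sum n.+1 x0.
by rewrite histS /cyl /= p0 mulr0 addr0 in_itv /= => /andP[h1]; rewrite ltNge h1.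
Qed.

End ReadingHistories.

(** * Construction of the Galton-Watson tree *)

Section Poisson.
Context {R : realType}.

Lemma poisson_sum (r : R) : 0 < r -> series (poisson_pmf r) @ \oo --> (1 : R).
Proof.
move=> r0.
have -> : series (poisson_pmf r) =
    (fun n => expR (- r) * series (exp_coeff r) n).
  apply/funext => n; rewrite !seriesEnat /= big_distrr /=; apply: eq_bigr => i _.
  by rewrite /poisson_pmf r0 mulrC /exp_coeff.
have -> : (1 : R) = expR (- r) * expR r by rewrite -expRD addNr expR0.
apply: cvgM; first exact: cvg_cst.
exact: is_cvg_series_exp_coeff.
Qed.

End Poisson.

Lemma offspring_rate_gt0 (R : realType) (q : nat) (a b : R) (i j : 'I_q) :
  0 < a -> 0 < b -> 0 < offspring_rate a b i j.
Proof.
move=> a0 b0; rewrite /offspring_rate divr_gt0 ?ltr0n //; first by case: ifP.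
exact: leq_ltn_trans (ltn_ord i).
Qed.

Section GW.
Context {R : realType} (q : nat) (a b : R) (i0 : 'I_q).
Hypotheses (a0 : 0 < a) (b0 : 0 < b).

Lemma q_gt0 : 0 < q%:R :> R.
Proof. by rewrite ltr0n; case: i0 => i; case: q. Qed.

(** The draw with number j.+1 is the offspring number of the pair (word, label)
    coded by j.  An index that codes no pair still needs some law; the Poisson
    law of mean 1 is an arbitrary choice. *)
Definition slot_pmf (s : 'I_q) (j : nat) : nat -> R :=
  if unpickle j is Some (u, i) then
    poisson_pmf (offspring_rate a b (word_label s u) i)
  else poisson_pmf 1.

Definition gw_pmf (h : seq nat) (k : nat) : R :=
  if h is _ :: h' then slot_pmf (insubd i0 (last 0%N h)) (size h') k
  else if (k < q)%N then q%:R^-1 else 0.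

Lemma gw_pmf_ge0 h k : 0 <= gw_pmf h k.
Proof.
case: h => [|m h] /=; first by case: ifP => // _; rewrite invr_ge0 ltW // q_gt0.
by rewrite /slot_pmf; case: unpickle => [[u i]|]; exact: poisson_pmf_ge0.
Qed.

Lemma gw_pmf_sum h : series (gw_pmf h) @ \oo --> (1 : R).
Proof.
case: h => [|m h].
  apply/cvgrPdist_lt => e e0; exists q => // n /= qn.
  rewrite seriesEnat /= (big_cat_nat (n := q)) //=.
  rewrite [X in _ - (_ + X)]big_nat [X in _ - (_ + X)]big1 ?addr0; last first.
    by move=> i /andP[qi _]; rewrite ltnNge qi.
  rewrite big_nat (eq_bigr (fun=> q%:R^-1)); last by move=> i /andP[_ ->].
  rewrite -big_nat sumr_const_nat subn0 -[X in X *+ _]mulr1 -mulrnAr.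
  by rewrite mulVf ?gt_eqF ?q_gt0 // subrr normr0.
rewrite /gw_pmf /slot_pmf; case: unpickle => [[u i]|]; apply: poisson_sum => //.
exact: offspring_rate_gt0.
Qed.

Definition gw_tree (x : R) : ltree q :=
  LTree (insubd i0 (draw gw_pmf x 0))
        (fun u i => draw gw_pmf x (pickle (u, i)).+1).

Lemma root_draw x (s : 'I_q) :
  lt_root_label (gw_tree x) = s <-> draw gw_pmf x 0 = s.
Proof.
have H : (draw gw_pmf x 0 < q)%N.
  case: (ltnP (draw gw_pmf x 0) q) => // h.
  have d0 : draw gw_pmf x 0 = 0%N.
    by apply: (draw_supp gw_pmf_ge0 gw_pmf_sum); rewrite /= ltnNge h.
  by move: h; rewrite d0 leqn0 => /eqP q0; case: (i0) => i; rewrite q0.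
split => [<- /=|e]; first by rewrite val_insubd H.
by apply: val_inj; rewrite /= val_insubd e ltn_ord.
Qed.

(** Constraints C on the first n offspring draws.  Draws that are not constrained
    are summed out for free, because the induction on n skips them; this is
    what turns the chain rule into a formula for finite-dimensional laws. *)
Lemma gw_draws_prob (s : 'I_q) (C : nat -> option nat) n :
  unif01 (R:=R) [set x | draw gw_pmf x 0 = s /\
    forall j k, (j < n)%N -> C j = Some k -> draw gw_pmf x j.+1 = k] =
  (q%:R^-1 * \prod_(j < n) (if C j is Some k then slot_pmf s j k else 1))%:E.
Proof.
elim: n => [|n IH].
  rewrite big_ord0 mulr1.
  have H h : setT h -> size h = 0%N -> gw_pmf h s = q%:R^-1.
    by move=> _ /size0nil -> /=; rewrite ltn_ord.
  have := draw_cond gw_pmf_ge0 gw_pmf_sum H.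
  rewrite [X in (_ * unif01 X)%E](_ : _ = setT) ?probability_setT ?mule1; last first.
    by apply/seteqP; split.
  move=> <-; congr (unif01 _); apply/seteqP; split => x /= [] //.
rewrite big_ord_recr /= mulrA.
case Cn: (C n) => [k|]; last first.
  rewrite mulr1 -IH; congr (unif01 _); apply/seteqP; split => x /= [-> H]; split => // j k jn.
    by apply: H; rewrite ltnS ltnW.
  by move: jn; rewrite ltnS leq_eqVlt => /orP[/eqP ->|/H H' /H' //]; rewrite Cn.
rewrite EFinM -IH muleC.
pose E : set (seq nat) := [set h | last 0%N h = s /\
   forall j k, (j < n)%N -> C j = Some k -> nth 0%N h (n - j.+1) = k].
have EE x : E (hist gw_pmf x n.+1) <-> (draw gw_pmf x 0 = s /\
    forall j k, (j < n)%N -> C j = Some k -> draw gw_pmf x j.+1 = k).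
  rewrite /E /mkset last_hist; split => -[-> H]; split => // j k' jn Cj.
    by rewrite -(@nth_hist _ gw_pmf x n.+1) // subSS; exact: H jn Cj.
  by rewrite -subSS nth_hist //; exact: H.
have H h : E h -> size h = n.+1 -> gw_pmf h k = slot_pmf s n k.
  case: h => [//|m h] [hs _] [<-]; rewrite /gw_pmf hs; congr (slot_pmf _ _ _).
  by apply: val_inj; rewrite val_insubd ltn_ord.
have := draw_cond gw_pmf_ge0 gw_pmf_sum H => {H}.
rewrite (_ : [set x | E (hist gw_pmf x n.+1)] = [set x | draw gw_pmf x 0 = s /\
    forall j k, (j < n)%N -> C j = Some k -> draw gw_pmf x j.+1 = k]); last first.
  by apply/seteqP; split => x /EE.
move=> <-; congr (unif01 _); apply/seteqP; split => x /=.
  move=> [x0 H]; split; last by apply: H Cn.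
  by apply/EE; split => // j k' jn; apply: H; rewrite ltnS ltnW.
move=> [/EE [x0 H] xk]; split => // j k'.
by rewrite ltnS leq_eqVlt => /orP[/eqP ->|]; [rewrite Cn => -[<-]|exact: H].
Qed.

Lemma gw_tree_is_gw : is_gw (unif01 (R:=R)) a b gw_tree.
Proof.
have mD j (k : nat) : measurable ([set x | draw gw_pmf x j = k] : set (measurableTypeR R)).
  exact: (measurable_hist gw_pmf_ge0 gw_pmf_sum j.+1 [set h | head 0%N h = k]).
split.
- move=> s; rewrite (_ : [set x | _] = [set x | draw gw_pmf x 0 = s]); first exact: mD.
  by apply/seteqP; split => x /root_draw.
- by move=> u i k; exact: mD.
move=> s F k uF.
pose N := (\max_(c <- F) (pickle c).+1)%N.
pose C j := if pickle_inv j is Some c then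
  if (c : (word q * 'I_q)%type) \in F then Some (k c.1 c.2) else None else None.
have FN c : c \in F -> (pickle c < N)%N.
  by move=> cF; exact: (@leq_bigmax_seq _ F xpredT (fun c => (pickle c).+1) c cF isT).
transitivity (unif01 (R:=R) [set x | draw gw_pmf x 0 = s /\
    forall j k, (j < N)%N -> C j = Some k -> draw gw_pmf x j.+1 = k]).
  congr (unif01 _); apply/seteqP; split => x /= [].
    move=> /root_draw xs H; split => // j k' jN; rewrite /C.
    have := @pickle_invK (word q * 'I_q)%type j.
    case: pickle_inv => //= -[u i] <- /=; case: ifP => // uF' -[<-].
    exact: H.
  move=> xs H; split; first exact/root_draw.
  move=> u i uiF; apply: H; first exact: FN.
  by rewrite /C pickleK_inv uiF.
rewrite gw_draws_prob; congr (EFin (_ * _)).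
pose f j := if C j is Some k0 then slot_pmf s j k0 else 1.
rewrite -(big_mkord xpredT f) /index_iota subn0.
rewrite (bigID (fun j => j \in map pickle F)) /= [X in _ * X]big1 ?mulr1; last first.
  move=> j; rewrite /f /C; have := @pickle_invK (word q * 'I_q)%type j.
  case: pickle_inv => //= c <-; rewrite mem_map; last exact: (pcan_inj pickleK).
  by case: ifP.
rewrite -big_filter (perm_big (map pickle F)) /=; last first.
  apply: uniq_perm; first by rewrite filter_uniq // iota_uniq.
    by rewrite map_inj_uniq //; exact: (pcan_inj pickleK).
  move=> j; rewrite mem_filter mem_iota add0n /=.
  case: (boolP (j \in _)) => //= /mapP[c cF ->]; exact: FN.
rewrite big_map big_seq [in RHS]big_seq; apply: eq_bigr => -[u i] cF.
by rewrite /f /C pickleK_inv cF /slot_pmf pickleK.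
Qed.
End GW.

(** * Vertex lists of truncated trees *)

Section Trees.
Local Close Scope ring_scope.
Variable q : nat.
Implicit Types (t : ltree q) (u w : word q).

Lemma in_ltree0 t : in_ltree t [::].
Proof. by move=> u c u' /esym/(congr1 size); rewrite size_cat /= addnS. Qed.

Lemma in_ltree_rcons t u c :
  in_ltree t (rcons u c) <-> in_ltree t u /\ (c.2 < lt_offspring t u c.1)%N.
Proof.
split => [H|[Hu Hc]].
  split; last by apply: (H u c [::]); rewrite cats1.
  by move=> u1 c1 u2 e; apply: (H u1 c1 (rcons u2 c)); rewrite e rcons_cat.
move=> u1 c1 u2; case/lastP: u2 => [|u2 c2].
  by rewrite cats1 => /rcons_inj[<- <-].
rewrite -rcons_cons -rcons_cat => /rcons_inj[e _]; exact: Hu e.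
Qed.

Definition children t u : seq (word q) :=
  [seq rcons u (i, k) | i <- enum 'I_q, k <- iota 0 (lt_offspring t u i)].

Fixpoint level t r : seq (word q) :=
  if r is r'.+1 then [seq w | u <- level t r', w <- children t u] else [:: [::]].

Definition verts t r : seq (word q) := [seq w | j <- iota 0 r.+1, w <- level t j].

Lemma mem_children t u w :
  w \in children t u <-> exists2 c, w = rcons u c & (c.2 < lt_offspring t u c.1)%N.
Proof.
split.
  by move=> /allpairsPdep[i [k [_]]]; rewrite mem_iota add0n => kk ->; exists (i, k).
move=> [[i k] -> kk]; apply/allpairsPdep; exists i, k; split => //.
  by rewrite mem_enum.
by rewrite mem_iota add0n.
Qed.

Lemma mem_level t r w : w \in level t r <-> in_ltree t w /\ size w = r.
Proof.
elim: r w => [|r IH] w /=.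
  rewrite inE; split => [/eqP ->|[_ /size0nil ->] //].
  by split => //; exact: in_ltree0.
split.
  move=> /allpairsPdep[u [w' [/IH[Tu su] /mem_children[c e h] ->]]].
  by rewrite e size_rcons su; split => //; apply/in_ltree_rcons.
case/lastP: w => [[]//|u c] []; rewrite size_rcons => /in_ltree_rcons[Tu h] [su].
apply/allpairsPdep; exists u, (rcons u c); split => //; first exact/IH.
by apply/mem_children; exists c.
Qed.

Lemma mem_verts t r w : w \in verts t r <-> in_ltree t w /\ (size w <= r)%N.
Proof.
split.
  move=> /allpairsPdep[j [w' [jr /mem_level[Tw sw] ->]]]; split => //.
  by move: jr; rewrite mem_iota sw.
move=> [Tw sw]; apply/allpairsPdep; exists (size w), w; split => //.
  by rewrite mem_iota.
exact/mem_level.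
Qed.

Lemma verts_prefix t r u c : rcons u c \in verts t r -> u \in verts t r.
Proof.
move=> /mem_verts[/in_ltree_rcons[Tu _]]; rewrite size_rcons => su.
by apply/mem_verts; split => //; exact: ltnW.
Qed.

Lemma verts_rcons t r u i k : rcons u (i, k) \in verts t r <->
  [/\ u \in verts t r, (size u < r)%N & (k < lt_offspring t u i)%N].
Proof.
split.
  move=> H; have := H; move=> /mem_verts[/in_ltree_rcons[Tu h]].
  by rewrite size_rcons => su; split => //; exact: verts_prefix H.
move=> [/mem_verts[Tu _] su h]; apply/mem_verts; rewrite size_rcons; split => //.
exact/in_ltree_rcons.
Qed.

Lemma uniq_children t u : uniq (children t u).
Proof.
apply: allpairs_uniq_dep; first exact: enum_uniq.
  by move=> i _; exact: iota_uniq.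
by move=> [i k] [i' k'] _ _ /= /rcons_inj[] -> ->.
Qed.

Lemma uniq_level t r : uniq (level t r).
Proof.
elim: r => //= r IH; apply: allpairs_uniq_dep => //.
  by move=> u _; exact: uniq_children.
move=> [u w] [u' w'] /allpairsPdep[u1 [w1 [_ h1 e1]]].
move=> /allpairsPdep[u2 [w2 [_ h2 e2]]] /= ew.
move: h1 h2; case: e1 e2 => -> -> [-> ->] in ew *.
rewrite -ew => /mem_children[c -> _] /mem_children[c' /rcons_inj[-> _] _].
by [].
Qed.

Lemma uniq_verts t r : uniq (verts t r).
Proof.
apply: allpairs_uniq_dep; first exact: iota_uniq.
  by move=> j _; exact: uniq_level.
move=> [j w] [j' w'] /allpairsPdep[j1 [w1 [_ /mem_level[_ h1] e1]]].
move=> /allpairsPdep[j2 [w2 [_ /mem_level[_ h2] e2]]] /= ew.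
by case: e1 e2 h1 h2 => <- <- [<- <-] <- <-; rewrite ew.
Qed.

Definition inner t r := [seq u <- verts t r | (size u < r)%N].

Definition blocks t r : seq (word q * 'I_q) :=
  [seq (u, i) | u <- inner t r, i <- enum 'I_q].

Lemma mem_blocks t r u i :
  (u, i) \in blocks t r = (u \in verts t r) && (size u < r)%N.
Proof.
apply/idP/idP.
  by move=> /allpairsPdep[u' [i' [+ _ [-> _]]]]; rewrite mem_filter andbC.
move=> /andP[h1 h2]; apply/allpairsPdep; exists u, i.
by rewrite mem_filter h1 h2 mem_enum.
Qed.

Lemma uniq_blocks t r : uniq (blocks t r).
Proof.
apply: allpairs_uniq_dep.
- by rewrite filter_uniq // uniq_verts.
- by move=> *; exact: enum_uniq.
- by move=> [u i] [u' i'] _ _ /= [-> ->].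
Qed.

Definition block_verts t (c : word q * 'I_q) : seq (word q) :=
  [seq rcons c.1 (c.2, k) | k <- iota 0 (lt_offspring t c.1 c.2)].

Lemma mem_block_verts t c w : w \in block_verts t c <->
  exists2 k, w = rcons c.1 (c.2, k) & (k < lt_offspring t c.1 c.2)%N.
Proof.
split; first by move=> /mapP[k]; rewrite mem_iota add0n => h ->; exists k.
by move=> [k -> h]; apply/mapP; exists k; rewrite // mem_iota add0n.
Qed.

(** Every vertex other than the root is a child of exactly one block, at exactly
    one rank; products over the vertices thereby become products over blocks. *)
Lemma perm_verts t r :
  perm_eq (verts t r) ([::] :: flatten [seq block_verts t c | c <- blocks t r]).
Proof.
apply: uniq_perm; first exact: uniq_verts.
  apply/andP; split.
    apply/negP => /flatten_mapP[c _ /mem_block_verts[k /(congr1 size)]].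
    by rewrite size_rcons.
  rewrite -[X in flatten X](map_id [seq block_verts t c | c <- blocks t r]).
  rewrite -map_comp.
  have -> : flatten [seq block_verts t c | c <- blocks t r] =
     [seq w | c <- blocks t r, w <- block_verts t c].
    by rewrite /allpairs_dep; congr flatten; apply: eq_map => c; rewrite map_id.
  apply: allpairs_uniq_dep; first exact: uniq_blocks.
    move=> c _; rewrite map_inj_uniq ?iota_uniq //.
    by move=> k k' /rcons_inj[].
  move=> [c w] [c' w'] /allpairsPdep[c1 [w1 [_ h1 [-> ->]]]].
  move=> /allpairsPdep[c2 [w2 [_ h2 [-> ->]]]] /= e.
  move: h1 h2; rewrite e => /mem_block_verts[k1 -> _] /mem_block_verts[k2 + _].
  by move=> /rcons_inj[]; case: (c1) (c2) => [u i] [u' i'] /= -> -> _.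
move=> w; case/lastP: w => [|u [i k]].
  have -> : [::] \in verts t r by apply/mem_verts; split => //; exact: in_ltree0.
  by rewrite inE eqxx.
rewrite [RHS]in_cons; case: eqP => [/(congr1 size)|_]; first by rewrite size_rcons.
rewrite orFb; apply/idP/idP.
  move=> /verts_rcons[h1 h2 h3]; apply/flatten_mapP; exists (u, i).
    by rewrite mem_blocks h1.
  by apply/mem_block_verts; exists k.
move=> /flatten_mapP[[u' i']]; rewrite mem_blocks => /andP[h1 h2].
by move=> /mem_block_verts[k' /rcons_inj[-> -> ->] h3]; apply/verts_rcons.
Qed.

Lemma size_verts t r :
  size (verts t r) = (\sum_(c <- blocks t r) lt_offspring t c.1 c.2).+1.
Proof.
rewrite (perm_size (perm_verts t r)) /= size_flatten /shape -map_comp sumnE big_map.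
by congr S; apply: eq_bigr => c _; rewrite /= size_map size_iota.
Qed.

Lemma size_inner_le t r : (size (inner t r) <= size (verts t r))%N.
Proof. by rewrite size_filter count_size. Qed.

(** The truncated tree as an element of a countable type: events about the
    truncated tree are countable unions of events that prescribe its code. *)
Definition tree_code r t : ('I_q * seq (word q))%type := (lt_root_label t, verts t r).

(** Together with [code_offspring]: prescribing the code of a tree is prescribing
    its root label and the finitely many offspring numbers of its blocks. *)
Lemma eq_code r t t' : lt_root_label t = lt_root_label t' ->
  (forall u i, (u, i) \in blocks t r -> lt_offspring t' u i = lt_offspring t u i) ->
  tree_code r t = tree_code r t'.
Proof.
move=> e H; rewrite /tree_code e; congr pair.
have L j : (j <= r)%N -> level t j = level t' j.
  elim: j => // j IH jr /=; rewrite -(IH (ltnW jr)).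
  congr flatten; apply/eq_in_map => u /mem_level[Tu su].
  congr map; rewrite /children; congr flatten; apply/eq_in_map => i _.
  rewrite H // mem_blocks su jr andbT.
  by apply/mem_verts; rewrite su; split => //; exact: ltnW.
congr flatten; apply/eq_in_map => j; rewrite mem_iota add0n ltnS => /andP[_ jr].
by rewrite L.
Qed.

Lemma code_offspring r t t' u i : tree_code r t = tree_code r t' ->
  (u, i) \in blocks t r -> lt_offspring t' u i = lt_offspring t u i.
Proof.
move=> /(congr1 snd); rewrite /tree_code /snd => e.
rewrite mem_blocks => /andP[uV su].
have H k : (k < lt_offspring t u i)%N = (k < lt_offspring t' u i)%N.
  apply/idP/idP => h.
    have /verts_rcons[] // : rcons u (i, k) \in verts t' r.
    by rewrite -e; apply/verts_rcons.
  have /verts_rcons[] // : rcons u (i, k) \in verts t r.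
  by rewrite e; apply/verts_rcons; rewrite -e.
apply/eqP; rewrite eqn_leq; apply/andP; split.
  by rewrite leqNgt -H ltnn.
by rewrite leqNgt H ltnn.
Qed.

End Trees.

(** * Probabilities of events about the Galton-Watson tree *)

Section PoissonTail.
Context {R : realType}.
Implicit Type r : R.

Definition poisson_tail r k : R := 1 - \sum_(j < k.+1) poisson_pmf r j.

Lemma poisson_pmfS r j : 0 < r -> j.+1%:R * poisson_pmf r j.+1 = r * poisson_pmf r j.
Proof.
move=> r0; rewrite /poisson_pmf r0 factS natrM invfM exprS.
have j0 : j.+1%:R != 0 :> R by rewrite pnatr_eq0.
have f0 : j`!%:R != 0 :> R by rewrite pnatr_eq0 -lt0n fact_gt0.
by move: (j.+1%:R) (j`!%:R) j0 f0 => x y x0 y0; field; rewrite ?x0 ?y0.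
Qed.

Lemma poisson_sum_le1 r n : 0 < r -> \sum_(j < n) poisson_pmf r j <= 1.
Proof.
move=> r0; rewrite -(big_mkord xpredT).
have := @cdf_series_le1 R (fun _ => poisson_pmf r) (fun _ _ => poisson_pmf_ge0 _ _)
  (fun _ => poisson_sum r0) [::] n.
by rewrite seriesEnat.
Qed.

Lemma poisson_tail_ge0 r k : 0 < r -> 0 <= poisson_tail r k.
Proof. by move=> r0; rewrite subr_ge0 poisson_sum_le1. Qed.

Lemma poisson_mean_part r n : 0 < r -> \sum_(j < n) poisson_pmf r j *+ j <= r.
Proof.
move=> r0; case: n => [|n]; first by rewrite big_ord0 ltW.
rewrite big_ord_recl mulr0n add0r.
rewrite (eq_bigr (fun j : 'I_n => r * poisson_pmf r j)); last first.
  by move=> j _; rewrite -poisson_pmfS // mulr_natl.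
by rewrite -mulr_sumr ler_piMr ?(ltW r0) // poisson_sum_le1.
Qed.

(** The tail formula for the mean: the sums of P(N > k) over k < K stay below the
    mean r.  For partial sums of the masses this is an exchange of summations
    and the identity j * pmf j = r * pmf (j - 1); then pass to the limit. *)
Lemma poisson_tail_sum r K : 0 < r -> \sum_(k < K) poisson_tail r k <= r.
Proof.
move=> r0.
pose S n := \sum_(j < n) poisson_pmf r j.
have H n : \sum_(k < K) (S n - S k.+1) <= r.
  apply: le_trans (poisson_mean_part n r0).
  apply: (@le_trans _ _ (\sum_(k < K) \sum_(j < n | (k < j)%N) poisson_pmf r j)).
    apply: ler_sum => k _; rewrite lerBlDr {1}/S (bigID (fun j : 'I_n => (k < j)%N)) /=.
    rewrite lerD2l /S -!(big_mkord (fun j => ~~ (k < j)%N)) -(big_mkord xpredT).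
    have [nk|kn] := leqP n k.+1.
      rewrite [X in _ <= X](big_cat_nat (n := n)) //= big_mkcond /=.
      rewrite ler_wpDr ?sumr_ge0 //; first by move=> *; exact: poisson_pmf_ge0.
      by apply: ler_sum => j _; case: ifP => // _; exact: poisson_pmf_ge0.
    rewrite (big_cat_nat (n := k.+1)) //=; last exact: ltnW.
    rewrite [X in _ + X]big_nat_cond [X in _ + X]big1 ?addr0; last first.
      by move=> j /andP[/andP[h1 h2] h3]; move: h3; rewrite h1.
    rewrite big_mkcond /=.
    by apply: ler_sum => j _; case: ifP => // _; exact: poisson_pmf_ge0.
  rewrite (exchange_big_dep xpredT) //=; apply: ler_sum => j _.
  rewrite sumr_const; apply: ler_wpMn2l; first exact: poisson_pmf_ge0.
  rewrite cardE -[leqRHS](size_iota 0 j) -(size_map val).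
  apply: uniq_leq_size; first by rewrite map_inj_uniq ?enum_uniq //; exact: val_inj.
  by move=> _ /mapP[k + ->]; rewrite mem_enum mem_iota.
have C : (fun n => \sum_(k < K) (S n - S k.+1)) @ \oo --> \sum_(k < K) poisson_tail r k.
  apply: cvg_big => [|k _]; first exact: add_continuous.
  apply: cvgB; last exact: cvg_cst.
  have := poisson_sum r0; rewrite (_ : series _ = S) //.
  by apply/funext => n; rewrite seriesEnat /= /S big_mkord.
by apply: (cvgr_to_le C); apply: nearW => n; exact: H.
Qed.

End PoissonTail.

Section GWProb.
Context {R : realType} {d : measure_display} {Omega : measurableType d}.
Variable P : probability Omega R.
Variables (q : nat) (a b : R) (T : Omega -> ltree q).
Hypothesis gwT : is_gw P a b T.
Implicit Types (s : 'I_q).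

Let mroot s : measurable [set x | lt_root_label (T x) = s].
Proof. by case: gwT. Qed.

Let moff u i k : measurable [set x | lt_offspring (T x) u i = k].
Proof. by case: gwT. Qed.

Lemma measurable_off (Q : set nat) u i : measurable [set x | Q (lt_offspring (T x) u i)].
Proof.
rewrite (_ : [set x | _] =
    \bigcup_(k in Q) [set x | lt_offspring (T x) u i = k]).
  by apply: measurable_bigcup_countType => k; exact: moff.
apply/seteqP; split => x /=; last by move=> [k Qk ->].
by move=> Qx; exists (lt_offspring (T x) u i).
Qed.

Lemma measurable_forall (I : eqType) (F : seq I) (A : I -> set Omega) :
  (forall i, measurable (A i)) -> measurable [set x | forall i, i \in F -> A i x].
Proof.
move=> mA; elim: F => [|i F IH].
  by rewrite (_ : [set x | _] = setT) //; apply/seteqP; split.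
rewrite (_ : [set x | _] = A i `&` [set x | forall i, i \in F -> A i x]).
  exact: measurableI.
apply/seteqP; split => x /=.
  move=> H; split; first by apply: H; rewrite mem_head.
  by move=> j jF; apply: H; rewrite inE jF orbT.
by move=> [h1 h2] j; rewrite inE => /predU1P[->//|]; exact: h2.
Qed.

(** The event that the code is a given one is either empty or a finite
    intersection of events that fix one offspring number. *)
Lemma measurable_code r (Q : set ('I_q * seq (word q))) :
  measurable [set x | Q (tree_code r (T x))].
Proof.
rewrite (_ : [set x | _] = \bigcup_(c in Q) [set x | tree_code r (T x) = c]); last first.
  by apply/seteqP; split => x /=; [move=> Qx; exists (tree_code r (T x))|move=> [k Qk ->]].
apply: measurable_bigcup_countType => c.
have [[x0 <-]|ne] := pselect (exists x0, tree_code r (T x0) = c); last first.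
  rewrite (_ : [set x | _] = set0) //.
  by apply/seteqP; split => x //= h; apply: ne; exists x.
rewrite (_ : [set x | _] = [set x | lt_root_label (T x) = lt_root_label (T x0)] `&`
  [set x | forall c, c \in blocks (T x0) r ->
     lt_offspring (T x) c.1 c.2 = lt_offspring (T x0) c.1 c.2]).
  apply: measurableI => //; apply: (@measurable_forall _ _ (fun c =>
    [set x | lt_offspring (T x) c.1 c.2 = lt_offspring (T x0) c.1 c.2])) => c'.
  exact: moff.
apply/seteqP; split => x /=.
  move=> e; split; first exact: (congr1 fst e).
  by move=> [u i] ui; apply: (code_offspring _ ui).
by move=> [e1 e2]; apply/esym/eq_code => // u i ui; exact: (e2 (u, i)).
Qed.

Lemma gw_code_prob r t : P [set x | tree_code r (T x) = tree_code r t] =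
  (q%:R^-1 * \prod_(c <- blocks t r)
     poisson_pmf (offspring_rate a b (word_label (lt_root_label t) c.1) c.2)
       (lt_offspring t c.1 c.2))%:E.
Proof.
case: gwT => _ _ /(_ (lt_root_label t) (blocks t r) (lt_offspring t) (uniq_blocks t r)) <-.
congr (P _); apply/seteqP; split => x /=.
  move=> e; split; first exact: (congr1 fst e).
  by move=> u i ui; apply: (code_offspring _ ui).
by move=> [e1 e2]; apply/esym/eq_code.
Qed.

(** Strict lower bounds on some offspring numbers (G) together with exact values
    of others (F), which the induction of [gw_event_prob] produces. *)
Definition gw_event s (G : seq ((word q * 'I_q) * nat)) (F : seq (word q * 'I_q))
    (k : word q -> 'I_q -> nat) : set Omega :=
  [set x | [/\ lt_root_label (T x) = s,
     forall g, g \in G -> (g.2 < lt_offspring (T x) g.1.1 g.1.2)%N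
   & forall c, c \in F -> lt_offspring (T x) c.1 c.2 = k c.1 c.2]].

Lemma measurable_gw_event s G F k : measurable (gw_event s G F k).
Proof.
rewrite (_ : gw_event s G F k = [set x | lt_root_label (T x) = s] `&`
  [set x | forall g, g \in G -> [set x | (g.2 < lt_offspring (T x) g.1.1 g.1.2)%N] x] `&`
  [set x | forall c, c \in F -> [set x | lt_offspring (T x) c.1 c.2 = k c.1 c.2] x]).
  apply: measurableI; [apply: measurableI => //|]; apply: measurable_forall => c.
    exact: (measurable_off [set m | (c.2 < m)%N]).
  exact: moff.
by apply/seteqP; split => x /= [] => [h1 h2 h3|[h1 h2] h3].
Qed.

Let rate s (c : word q * 'I_q) : R := offspring_rate a b (word_label s c.1) c.2.

(** A lower bound on one offspring number is reached from no constraint by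
    removing, one by one, the finitely many values below it.  Each removed event
    has one more exact value, so the formula for exact values suffices and no
    infinite sum appears. *)
Lemma gw_event_prob s G F k : uniq (map fst G ++ F) ->
  P (gw_event s G F k) = (q%:R^-1 * \prod_(g <- G) poisson_tail (rate s g.1) g.2
    * \prod_(c <- F) poisson_pmf (rate s c) (k c.1 c.2))%:E.
Proof.
elim: G F k => [|g G IH] F k /=.
  move=> uF; rewrite big_nil mulr1; case: gwT => _ _ /(_ s F k uF) <-.
  congr (P _); apply/seteqP; split => x /=.
    by move=> [h1 _ h3]; split => // u i ui; exact: (h3 (u, i)).
  by move=> [h1 h2]; split => // -[u i] ui; exact: h2.
rewrite mem_cat negb_or => /andP[/andP[gG gF] uGF].
pose A h := gw_event s G F k `&` [set x | (h <= lt_offspring (T x) g.1.1 g.1.2)%N].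
have mA h : measurable (A h).
  apply: measurableI; first exact: measurable_gw_event.
  exact: (measurable_off [set m | (h <= m)%N]).
pose p0 := q%:R^-1 * \prod_(g <- G) poisson_tail (rate s g.1) g.2
    * \prod_(c <- F) poisson_pmf (rate s c) (k c.1 c.2).
have PA h : P (A h) = (p0 * (1 - \sum_(j < h) poisson_pmf (rate s g.1) j))%:E.
  elim: h => [|h IHh].
    by rewrite big_ord0 subr0 mulr1 -IH //; congr (P _); apply/seteqP; split => x //= [].
  pose k' u i := if (u, i) == g.1 then h else k u i.
  have AE : A h = A h.+1 `|` gw_event s G (g.1 :: F) k'.
    apply/seteqP; split => x /=.
      move=> [[h1 h2 h3]]; rewrite /= leq_eqVlt => /predU1P[e|h4]; last by left.
      right; split => // c; rewrite inE => /predU1P[->|cF].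
        by rewrite /k' -surjective_pairing eqxx.
      rewrite h3 // /k' -surjective_pairing; case: eqP => // e2.
      by move: cF gF; rewrite e2 => ->.
    move=> [[h1 /= h2]|[h1 h2 h3]]; first by split => //; exact: ltnW.
    split; last first.
      by rewrite /= (h3 _ (mem_head _ _)) /k' -surjective_pairing eqxx.
    split => // c cF; rewrite h3 ?inE ?cF ?orbT // /k' -surjective_pairing.
    by case: eqP => // e; move: cF gF; rewrite e => ->.
  have dis : A h.+1 `&` gw_event s G (g.1 :: F) k' = set0.
    apply/seteqP; split => // x /= [[_ /= h1] [_ _ /(_ _ (mem_head _ _))]].
    by rewrite /k' -surjective_pairing eqxx => e'; move: h1; rewrite e' ltnn.
  have u' : uniq (map fst G ++ g.1 :: F).
    by rewrite -cat1s uniq_catCA /= mem_cat negb_or gG gF.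
  have kE : \prod_(c <- g.1 :: F) poisson_pmf (rate s c) (k' c.1 c.2) =
      poisson_pmf (rate s g.1) h * \prod_(c <- F) poisson_pmf (rate s c) (k c.1 c.2).
    rewrite big_cons {1}/k' -surjective_pairing eqxx; congr (_ * _).
    rewrite big_seq [RHS]big_seq; apply: eq_bigr => c cF.
    rewrite /k' -surjective_pairing; case: eqP => // e'.
    by move: cF gF; rewrite e' => ->.
  have aux (x : \bar R) (y z : R) : (x + y%:E = z%:E -> x = (z - y)%:E)%E.
    by move=> /(congr1 (fun t => t - y%:E)%E); rewrite addeK // -EFinB.
  have := IH _ k' u'; rewrite kE => IHk.
  have e : (P (A h.+1) + P (gw_event s G (g.1 :: F) k'))%E = P (A h).
    by rewrite AE measureU //; exact: measurable_gw_event.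
  move: e; rewrite IHk IHh => /aux ->.
  by congr EFin; rewrite big_ord_recr /= /p0; ring.
rewrite (_ : gw_event s (g :: G) F k = A g.2.+1).
  by rewrite PA big_cons /p0 /poisson_tail; congr EFin; ring.
apply/seteqP; split => x /=.
  move=> [h1 h2 h3]; split; last by apply: h2; rewrite mem_head.
  by split => // g' g'G; apply: h2; rewrite inE g'G orbT.
move=> [[h1 h2 h3] /= h4]; split => // g'; rewrite inE => /predU1P[-> //|].
exact: h2.
Qed.

End GWProb.

(** * The expected size of the truncated tree *)

Section Words.
Variable q : nat.
Implicit Types (w pre : word q).

(** The conditions for the word pre ++ w to be a vertex, once pre is one: at each
    step, the offspring number of the prefix exceeds the rank of the letter. *)
Fixpoint word_slots pre w : seq ((word q * 'I_q) * nat) :=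
  if w is c :: w' then ((pre, c.1), c.2) :: word_slots (rcons pre c) w' else [::].

Lemma in_ltree_word_slots (t : ltree q) pre w : in_ltree t (pre ++ w) <->
  in_ltree t pre /\
  forall g, g \in word_slots pre w -> (g.2 < lt_offspring t g.1.1 g.1.2)%N.
Proof.
elim: w pre => [|c w IH] pre; first by rewrite cats0; split => // -[].
rewrite -cat_rcons; split.
  move=> /IH[/in_ltree_rcons[Tp h] H]; split => // g.
  by rewrite inE => /predU1P[-> //|]; exact: H.
move=> [Tp H]; apply/IH; split.
  by apply/in_ltree_rcons; split => //; apply: (H _ (mem_head _ _)).
by move=> g gw; apply: H; rewrite inE gw orbT.
Qed.

Lemma word_slots_size pre w g : g \in word_slots pre w -> (size pre <= size g.1.1)%N.
Proof.
elim: w pre => //= c w IH pre; rewrite inE => /predU1P[->//|/IH].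
by rewrite size_rcons; exact: ltnW.
Qed.

Lemma uniq_word_slots pre w : uniq (map fst (word_slots pre w)).
Proof.
elim: w pre => //= c w IH pre; rewrite IH andbT.
apply/negP => /mapP[g /word_slots_size + e]; rewrite -e size_rcons /=.
by rewrite ltnn.
Qed.

Definition letters K : seq ('I_q * nat) :=
  [seq (i, k) | i <- enum 'I_q, k <- iota 0 K].

Fixpoint words K r : seq (word q) :=
  if r is r'.+1 then [seq c :: w | c <- letters K, w <- words K r'] else [:: [::]].

Lemma mem_words K w : all (fun c => c.2 < K)%N w -> w \in words K (size w).
Proof.
elim: w => //= -[i k] w IH /andP[/= kK wK]; apply/allpairsPdep.
exists (i, k), w; split => //; last exact: IH.
apply/allpairsPdep; exists i, k; split => //; first by rewrite mem_enum.
by rewrite mem_iota.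
Qed.

End Words.

Section Moment.
Context {R : realType} {d : measure_display} {Omega : measurableType d}.
Variable P : probability Omega R.
Variables (q : nat) (a b : R) (T : Omega -> ltree q).
Hypothesis gwT : is_gw P a b T.
Hypotheses (a0 : 0 < a) (b0 : 0 < b) (q0 : (0 < q)%N).
Implicit Types (s : 'I_q) (w : word q).

Let rate s (c : word q * 'I_q) : R := offspring_rate a b (word_label s c.1) c.2.

Lemma offspring_rate_sum_le (l : 'I_q) : \sum_i offspring_rate a b l i <= a + b.
Proof.
have qR : 0 < q%:R :> R by rewrite ltr0n.
rewrite /offspring_rate -mulr_suml ler_pdivrMr // (bigD1 l) //= eqxx.
rewrite mulrDl lerD //; first by rewrite ler_peMr ?ler1n // ltW.
apply: (@le_trans _ _ (\sum_(i : 'I_q | i != l) b)).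
  by apply: ler_sum => i; rewrite eq_sym => /negPf ->.
rewrite sumr_const -[X in X *+ _]mulr1 -mulrnAr ler_wpM2l ?(ltW b0) // ler_nat.
by rewrite (leq_trans (max_card _)) // card_ord.
Qed.

(** Summing over the first letter gives the sum of the tail probabilities over all
    labels and ranks, at most the mean a + b; the other letters are covered by
    the induction, whatever the label reached. *)
Lemma words_sum s pre K r :
  \sum_(w <- words q K r) \prod_(g <- word_slots pre w) poisson_tail (rate s g.1) g.2
  <= (a + b) ^+ r.
Proof.
elim: r pre => [|r IH] pre; first by rewrite /= big_seq1 big_nil.
rewrite /= big_allpairs_dep /=.
apply: (@le_trans _ _ (\sum_(c <- letters q K)
   poisson_tail (offspring_rate a b (word_label s pre) c.1) c.2 * (a + b) ^+ r)).
  apply: ler_sum => c _.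
  rewrite (eq_bigr (fun w => poisson_tail (offspring_rate a b (word_label s pre) c.1) c.2 *
     \prod_(g <- word_slots (rcons pre c) w) poisson_tail (rate s g.1) g.2)); last first.
    by move=> w _; rewrite big_cons.
  by rewrite -mulr_sumr ler_wpM2l // poisson_tail_ge0 // offspring_rate_gt0.
rewrite -mulr_suml exprS ler_wpM2r ?exprn_ge0 ?addr_ge0 ?(ltW a0) ?(ltW b0) //.
rewrite /letters big_allpairs_dep /=; apply: le_trans (offspring_rate_sum_le (word_label s pre)).
rewrite big_enum /=; apply: ler_sum => i _.
have := poisson_tail_sum K (offspring_rate_gt0 (word_label s pre) i a0 b0).
by rewrite -(big_mkord xpredT) /index_iota subn0.
Qed.

Lemma measurable_in_ltree w : measurable [set x | in_ltree (T x) w].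
Proof.
rewrite (_ : [set x | _] = [set x | w \in (tree_code (size w) (T x)).2]).
  exact: (measurable_code gwT (size w) [set c : 'I_q * seq (word q) | w \in c.2]).
by apply/seteqP; split => x /=; [move=> h; apply/mem_verts|move=> /mem_verts[]].
Qed.

Lemma in_ltree_prob w : P [set x | in_ltree (T x) w] =
  (\sum_(s : 'I_q) q%:R^-1 *
     \prod_(g <- word_slots [::] w) poisson_tail (rate s g.1) g.2)%:E.
Proof.
pose A s := gw_event T s (word_slots [::] w) [::] (fun _ _ => 0%N).
have -> : [set x | in_ltree (T x) w] = \bigcup_s A s.
  apply/seteqP; split => x /=.
    move=> /(@in_ltree_word_slots q (T x) [::] w)[_ H].
    by exists (lt_root_label (T x)).
  move=> [s _ [_ H _]]; apply/(@in_ltree_word_slots q (T x) [::] w); split => //.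
  exact: in_ltree0.
rewrite probability_bigcup_finType.
- rewrite -sumEFin; apply: eq_bigr => s _.
  rewrite (gw_event_prob gwT) ?big_nil ?mulr1 // cats0; exact: uniq_word_slots.
- by move=> s; exact: (measurable_gw_event gwT).
- by move=> s s' _ _ [x [[<- _ _] [<- _ _]]].
Qed.

Definition words_le K r : seq (word q) :=
  [seq w | j <- iota 0 r.+1, w <- words q K j].

Lemma words_le_sum K r : (\sum_(w <- words_le K r) P [set x | in_ltree (T x) w]
  <= (\sum_(j < r.+1) (a + b) ^+ j)%R%:E)%E.
Proof.
rewrite (eq_bigr (fun w => (\sum_(s : 'I_q) q%:R^-1 *
     \prod_(g <- word_slots [::] w) poisson_tail (rate s g.1) g.2)%:E)); last first.
  by move=> w _; rewrite in_ltree_prob.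
rewrite sumEFin lee_fin /words_le big_allpairs_dep.
rewrite -[iota 0 r.+1]/(index_iota 0 r.+1) big_mkord; apply: ler_sum => j _.
rewrite exchange_big /=.
apply: (@le_trans _ _ (\sum_(s : 'I_q) q%:R^-1 * (a + b) ^+ j)).
  by apply: ler_sum => s _; rewrite -mulr_sumr ler_wpM2l ?invr_ge0 // words_sum.
rewrite sumr_const card_ord -mulrnAl -mulr_natl mulfV ?mul1r //.
by rewrite pnatr_eq0 -lt0n.
Qed.

Lemma markov_sum_indic (I : eqType) (s : seq I) (A : I -> set Omega) (m B : R) :
  (forall i, measurable (A i)) -> 0 < m ->
  (\sum_(i <- s) P (A i) <= B%:E)%E ->
  forall E, measurable E -> (forall x, E x -> m <= \sum_(i <- s) \1_(A i) x) ->
  (P E <= (B / m)%:E)%E.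
Proof.
move=> mA m0 sB E mE EA.
have H : (m%:E * P E <= B%:E)%E.
  apply: le_trans sB.
  have -> : (m%:E * P E = \int[P]_x (m%:E * (\1_E x)%:E))%E.
    rewrite ge0_integralZl //=.
    - by rewrite integral_indic // setIT.
    - by apply/measurable_EFinP; exact: measurable_indic.
    - by rewrite lee_fin ltW.
  have -> : (\sum_(i <- s) P (A i) = \int[P]_x (\sum_(i <- s) (\1_(A i) x)%:E))%E.
    rewrite ge0_integral_sum //=.
    - by apply: eq_bigr => i _; rewrite integral_indic // setIT.
    - by move=> i; apply/measurable_EFinP; exact: measurable_indic.
  apply: ge0_le_integral => //=.
  - by move=> x _; rewrite mule_ge0 // lee_fin ltW.
  - apply: measurable_funeM; apply/measurable_EFinP.
    exact: measurable_indic.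
  - apply: emeasurable_sum => i; apply/measurable_EFinP.
    exact: measurable_indic.
  - move=> x _; rewrite sumEFin -EFinM lee_fin indicE.
    case: (boolP (x \in E)); last by rewrite mulr0 sumr_ge0.
    by rewrite inE mulr1 => /EA.
by move: H; rewrite -(fineK (fin_num_measure P E mE)) -EFinM !lee_fin ler_pdivlMr // mulrC.
Qed.

(** Words whose letters have rank less than K are finitely many, so Markov's
    inequality applies to the number of those that are vertices, with a bound
    that does not depend on K.  A tree of depth r has only finitely many
    vertices, hence the event is the increasing union over K. *)
Lemma size_verts_tail r (m : R) : 0 < m ->
  (P [set x | (m < (size (verts (T x) r))%:R)%R] <=
    ((\sum_(j < r.+1) (a + b) ^+ j) / m)%R%:E)%E.
Proof.
move=> m0.
pose E K := [set x | m < (size (verts (T x) r))%:R /\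
   all (all (fun c : 'I_q * nat => c.2 < K)%N) (verts (T x) r)].
have mE K : measurable (E K).
  exact: (measurable_code gwT r [set c : 'I_q * seq (word q) |
    m < (size c.2)%:R /\ all (all (fun c : 'I_q * nat => c.2 < K)%N) c.2]).
have EE : [set x | m < (size (verts (T x) r))%:R] = \bigcup_K E K.
  apply/seteqP; split => x /=; last by move=> [K _ []].
  move=> h; exists (\max_(w <- verts (T x) r) \max_(c <- w) c.2).+1 => //.
  split => //; apply/allP => w wV; apply/allP => c cw; rewrite ltnS.
  apply: leq_trans (@leq_bigmax_seq _ _ xpredT (fun c => c.2) c cw isT) _.
  exact: (@leq_bigmax_seq _ _ xpredT (fun w => \max_(c <- w) c.2) w wV isT).
have ndE : nondecreasing_seq E.
  move=> K K' KK; apply/subsetPset => x [h1 h2]; split => //.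
  apply: sub_all h2 => w; apply: sub_all => c cK; exact: leq_trans cK KK.
have C : (P \o E) @ \oo --> P (\bigcup_n E n).
  by apply: nondecreasing_cvg_mu => //; exact: bigcup_measurable.
rewrite EE -(cvg_lim _ C) //.
apply: lime_le; first by apply/cvg_ex; eexists; exact: C.
apply: nearW => K.
apply: (@markov_sum_indic _ (words_le K r) (fun w => [set x | in_ltree (T x) w])) => //.
- by move=> w; exact: measurable_in_ltree.
- exact: words_le_sum.
move=> x [h1 h2]; apply: le_trans (ltW h1) _.
have sE : \sum_(w <- words_le K r) \1_[set x | in_ltree (T x) w] x =
    (count (fun w => `[< in_ltree (T x) w >]) (words_le K r))%:R :> R.
  rewrite -sum1_count natr_sum [RHS]big_mkcond /=; apply: eq_bigr => w _.
  by rewrite indicE; case: asboolP => h; [rewrite mem_set|rewrite memNset].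
rewrite sE ler_nat -size_filter; apply: uniq_leq_size; first exact: uniq_verts.
move=> w wV; have [Tw sw] := (mem_verts _ _ _).1 wV.
rewrite mem_filter asboolT //=; apply/allpairsPdep; exists (size w), w; split => //.
  by rewrite mem_iota.
by apply: mem_words; exact: (allP h2).
Qed.

End Moment.

(** * Sums over graphs and the probability of an embedding *)

Section GraphSums.
Context {R : realType} (n : nat).

Lemma sg_adj_sym (g : sgraph n) i j : sg_adj g i j = sg_adj g j i.
Proof.
by have /andP[_ /forallP/(_ i)/forallP/(_ j)/eqP h] := valP g.
Qed.

Lemma sg_adj_irr (g : sgraph n) i : sg_adj g i i = false.
Proof.
by have /andP[/forallP/(_ i) /negPf h _] := valP g.
Qed.

(** A simple graph is a free choice of one bit for each pair i < j, so a sum over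
    graphs of a product over pairs factorizes. *)
Lemma sum_sgraph (phi : 'I_n -> 'I_n -> bool -> R) :
  \sum_(g : sgraph n) \prod_(i < n) \prod_(j < n | (i < j)%N) phi i j (sg_adj g i j)
  = \prod_(i < n) \prod_(j < n | (i < j)%N) (phi i j true + phi i j false).
Proof.
(* Pairs that are not increasing are forced to carry the bit false, so that the
   sum runs over all functions of pairs. *)
pose psi (e : 'I_n * 'I_n) b : R :=
  if (e.1 < e.2)%N then phi e.1 e.2 b else (~~ b)%:R.
transitivity (\prod_(e : 'I_n * 'I_n) \sum_(b : bool) psi e b); last first.
  rewrite pair_big_dep /= [RHS]big_mkcond /=; apply: eq_bigr => e _.
  by rewrite big_bool /psi /=; case: ifP => // _; rewrite add0r.
rewrite bigA_distr_bigA /=.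
rewrite (bigID (fun f : {ffun 'I_n * 'I_n -> bool} =>
   [forall e : 'I_n * 'I_n, f e ==> (e.1 < e.2)%N])) /= [X in _ = _ + X]big1 ?addr0; last first.
  move=> f /forallPn[e]; rewrite negb_imply => /andP[fe /negPf lt].
  by rewrite (bigD1 e) //= /psi lt fe mul0r.
pose h (g : sgraph n) : {ffun 'I_n * 'I_n -> bool} :=
  [ffun e : 'I_n * 'I_n => (e.1 < e.2)%N && val g e].
pose k0 (f : {ffun 'I_n * 'I_n -> bool}) : {ffun 'I_n * 'I_n -> bool} :=
  [ffun e : 'I_n * 'I_n => if (e.1 < e.2)%N then f e else
             if (e.2 < e.1)%N then f (e.2, e.1) else false].
have k0P f : simple_rel (k0 f).
  apply/andP; split; first by apply/forallP => i; rewrite ffunE /= ltnn.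
  apply/forallP => i; apply/forallP => j; rewrite !ffunE /=.
  by case: ltngtP.
pose k f : sgraph n := Sub (k0 f) (k0P f).
rewrite (reindex h); last first.
  exists k.
    move=> g _; apply: val_inj => /=; apply/ffunP => -[i j]; rewrite !ffunE /=.
    have S := sg_adj_sym g i j; have I := sg_adj_irr g i; rewrite /sg_adj in S I.
    case: ltngtP => //= e.
    by rewrite -(val_inj e); exact: esym I.
  move=> f; rewrite inE => /forallP H; apply/ffunP => -[i j]; rewrite !ffunE /=.
  have := H (i, j); case: ltngtP => //= _; first by rewrite implybF => /negPf ->.
  by rewrite implybF => /negPf ->.
rewrite [RHS](eq_bigl xpredT); last first.
  move=> g; rewrite [RHS]/=; apply/forallP => e; rewrite ffunE.
  by case: (_ < _)%N; rewrite ?implybT.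
apply: eq_bigr => g _; rewrite pair_big_dep /= big_mkcond /=.
apply: eq_bigr => -[i j] _; rewrite /psi /h ffunE /=.
by case: ifP => // lt.
Qed.

(** For collecting, at each vertex, the directed factors charged to it. *)
Lemma prod_offdiag (F : 'I_n -> 'I_n -> R) :
  \prod_(i < n) \prod_(j < n | (i < j)%N) (F i j * F j i) =
  \prod_(j < n) \prod_(i < n | i != j) F i j.
Proof.
under eq_bigr do rewrite big_split /=; rewrite big_split /=.
rewrite [X in X * _](exchange_big_dep xpredT) //=.
rewrite -big_split /=; apply: eq_bigr => j _.
rewrite [RHS](bigID (fun i : 'I_n => (i < j)%N)) /=; congr (_ * _).
  by apply: eq_bigl => i; rewrite neq_ltn; case: ltngtP.
by apply: eq_bigl => i; rewrite -(inj_eq val_inj) /=; case: ltngtP.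
Qed.

End GraphSums.

Section SBM.
Context {R : realType} (n q : nat) (a b : R).
Hypotheses (q0 : (0 < q)%N) (a0 : 0 < a) (b0 : 0 < b).

Local Notation prob := (@sbm_edge_prob R n a b).

Lemma edge_prob_ge0 s : 0 <= prob s.
Proof.
by rewrite /sbm_edge_prob le_min ler01 /=; case: s; rewrite divr_ge0 ?ler0n ?(ltW a0) ?(ltW b0).
Qed.

Lemma edge_prob_le1 s : prob s <= 1.
Proof. by rewrite /sbm_edge_prob ge_min lexx. Qed.

Lemma sbm_pmf_ge0 (g : sgraph n) (s : {ffun 'I_n -> 'I_q}) : 0 <= sbm_pmf a b g s.
Proof.
rewrite /sbm_pmf mulr_ge0 ?exprn_ge0 ?invr_ge0 //.
apply: prodr_ge0 => i _; apply: prodr_ge0 => j _ /=.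
by case: ifP => _; rewrite ?edge_prob_ge0 // subr_ge0 edge_prob_le1.
Qed.

Lemma sbm_pmf_sum :
  \sum_(x : sgraph n * {ffun 'I_n -> 'I_q}) sbm_pmf a b x.1 x.2 = 1.
Proof.
rewrite -(pair_bigA _ (fun (g : sgraph n) (s : {ffun 'I_n -> 'I_q}) => sbm_pmf a b g s)) /=.
rewrite exchange_big /= (eq_bigr (fun=> (q%:R^-1) ^+ n)); last first.
  move=> s _; rewrite /sbm_pmf -mulr_sumr.
  rewrite (sum_sgraph (fun i j c => if c then prob (s i == s j) else 1 - prob (s i == s j))).
  rewrite big1 ?mulr1 // => i _; rewrite big1 // => j _ /=; by rewrite addrC subrK.
rewrite sumr_const card_ffun !card_ord -[X in X *+ _]mulr1 -mulrnAr natrX -exprMn.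
by rewrite mulVf ?expr1n // pnatr_eq0 -lt0n.
Qed.

Section Embedding.
Variables (V I : {set 'I_n}) (v : 'I_n) (pr : 'I_n -> 'I_n) (lab : 'I_n -> 'I_q).
Hypothesis IV : I \subset V.
Hypothesis prV : forall w, w \in V -> w != v -> (pr w \in V) && (pr w != w).

Definition tree_adj i j := ((j != v) && (pr j == i)) || ((i != v) && (pr i == j)).

(** [V] is the set of placed vertices, [I] the set of those whose depth is less
    than the radius, [pr] the parent map.  Edges between vertices outside of [I]
    and vertices outside of [V] are left free. *)
Definition edge_ok i j (c : bool) : bool :=
  if (i \in V) && (j \in V) then c == tree_adj i j
  else if ((i \in I) && (j \notin V)) || ((j \in I) && (i \notin V)) then ~~ c
  else true.

Definition emb_ok (x : sgraph n * {ffun 'I_n -> 'I_q}) : bool :=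
  [forall u in V, x.2 u == lab u] &&
  [forall i, forall j, (i != j) ==> edge_ok i j (sg_adj x.1 i j)].

Variables (pm dn : R).
Hypotheses (pm1 : pm <= 1) (ppm : forall s, prob s <= pm).
Hypothesis pdn : forall l : 'I_q, \sum_(l' : 'I_q) prob (l == l') <= q%:R * dn.
Hypothesis dn1 : #|I|%:R * dn <= 1.
Hypothesis dn0 : 0 <= dn.

Lemma edge_ok_sym i j c : edge_ok i j c = edge_ok j i c.
Proof.
by rewrite /edge_ok andbC orbC /tree_adj [X in c == X]orbC.
Qed.

Lemma bernoulli_prod (J : Type) (r : seq J) (Q : pred J) (F : J -> R) :
  (forall i, 0 <= F i <= 1) ->
  1 - \sum_(i <- r | Q i) F i <= \prod_(i <- r | Q i) (1 - F i).
Proof.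
move=> F01; elim: r => [|i r IH]; first by rewrite !big_nil subr0.
rewrite !big_cons; case: ifP => // _; have /andP[h0 h1] := F01 i.
apply: (@le_trans _ _ ((1 - F i) * (1 - \sum_(j <- r | Q j) F j))).
  rewrite -subr_ge0 (_ : _ - _ = F i * \sum_(j <- r | Q j) F j); last by ring.
  by rewrite mulr_ge0 // sumr_ge0 // => j _; case/andP: (F01 j).
by rewrite ler_wpM2l // subr_ge0.
Qed.

(** A directed lower bound for the weight of a pair: a tree edge is charged to the
    child, a missing edge to the outside is charged to the outer vertex, and a
    missing edge between placed vertices is charged 1 - pm to each of its ends.
    If the placed vertices have their prescribed labels, the factors charged to
    j depend on the other labels no more. *)
Let pot (s : 'I_n -> 'I_q) i j : R :=
  if i \in V then
    if j \in V then
      if (j != v) && (pr j == i) then prob (lab i == lab j) else 1 - pm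
    else if i \in I then 1 - prob (lab i == s j) else 1
  else 1.

Let prob1 s : 0 <= 1 - prob s <= 1.
Proof. by rewrite subr_ge0 edge_prob_le1 lerBlDr lerDl edge_prob_ge0. Qed.

Let pm0 : 0 <= pm.
Proof. exact: le_trans (edge_prob_ge0 true) (ppm true). Qed.

Let pm01 : 0 <= 1 - pm <= 1.
Proof. by rewrite subr_ge0 pm1 lerBlDr lerDl pm0. Qed.

Let pot01 s i j : 0 <= pot s i j <= 1.
Proof.
rewrite /pot; case: (i \in V); last by rewrite ler01 lexx.
case: (j \in V); first by case: ifP => _ //; rewrite edge_prob_ge0 edge_prob_le1.
by case: (i \in I) => //; rewrite ler01 lexx.
Qed.

Let weight (s : {ffun 'I_n -> 'I_q}) i j : R :=
  (if edge_ok i j true then prob (s i == s j) else 0) +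
  (if edge_ok i j false then 1 - prob (s i == s j) else 0).

Let lab_ok j (l : 'I_q) : bool := (j \in V) ==> (l == lab j).

Let pot_weight (s : {ffun 'I_n -> 'I_q}) i j : (forall u, lab_ok u (s u)) -> i != j ->
  pot s i j * pot s j i <= weight s i j.
Proof.
move=> sl ij.
have sV u : u \in V -> s u = lab u by move=> uV; have := sl u; rewrite /lab_ok uV => /eqP.
have mm (x y : R) : 0 <= x <= 1 -> 0 <= y <= 1 -> x * y <= x.
  by move=> /andP[x0 _] /andP[_ y1]; rewrite ler_piMr.
have mm' (x y : R) : 0 <= x <= 1 -> 0 <= y <= 1 -> x * y <= y.
  by move=> /andP[_ x1] /andP[y0 _]; rewrite ler_piMl.
have I0 u : u \notin V -> (u \in I) = false.
  by apply: contraNF => /(fintype.subsetP IV).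
have [iV|iV] := boolP (i \in V); have [jV|jV] := boolP (j \in V).
- rewrite /weight /edge_ok iV jV andTb !(sV _ iV) !(sV _ jV).
  have pij := pot01 s i j; have pji := pot01 s j i.
  case T : (tree_adj i j); rewrite /= ?addr0 ?add0r.
    move: T => /orP[] T.
      by apply: le_trans (mm _ _ pij pji) _; rewrite /pot iV jV T.
    apply: le_trans (mm' _ _ pij pji) _; rewrite /pot iV jV T.
    by rewrite eq_sym.
  apply: le_trans (mm _ _ pij pji) _; rewrite /pot iV jV.
  move/negbT: T; rewrite negb_or => /andP[/negPf -> _].
  by rewrite lerD2l lerN2.
- rewrite /weight /edge_ok (negPf jV) andbF (I0 j jV) /= !orbF !andbT.
  rewrite [pot s j i]/pot (negPf jV) mulr1 /pot iV (negPf jV) (sV _ iV).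
  by case: (i \in I) => /=; rewrite ?add0r // addrC subrK.
- rewrite /weight /edge_ok (negPf iV) (I0 i iV) /= !andbT.
  rewrite [pot s i j]/pot (negPf iV) mul1r /pot jV (negPf iV) (sV _ jV) eq_sym.
  by case: (j \in I) => /=; rewrite ?add0r // addrC subrK.
- rewrite /weight /edge_ok (negPf iV) (I0 i iV) (I0 j jV) /= /pot (negPf iV) (negPf jV) mulr1.
  by rewrite addrC subrK.
Qed.

Let vert j (l : 'I_q) : R :=
  if j \in V then
    (if j != v then prob (lab (pr j) == lab j) else 1) * (1 - pm) ^+ #|V|
  else \prod_(i in I) (1 - prob (lab i == l)).

Let vert_pot (s : 'I_n -> 'I_q) j : vert j (s j) <= \prod_(i < n | i != j) pot s i j.
Proof.
rewrite /vert; case: (boolP (j \in V)) => jV; last first.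
  rewrite [leRHS](bigID (fun i => i \in I)) /= [X in _ * X]big1 ?mulr1; last first.
    move=> i /andP[_ /negPf iI]; rewrite /pot iI (negPf jV).
    by case: ifP.
  rewrite le_eqVlt; apply/orP; left; apply/eqP; apply: eq_big => [i|i iI].
    case: eqP => [->|//]; apply/negbTE; apply: contra jV; exact: (fintype.subsetP IV).
  by rewrite /pot (fintype.subsetP IV _ iI) (negPf jV) iI.
have H Q : (1 - pm) ^+ #|V| <= \prod_(i in V | Q i) (1 - pm).
  rewrite prodr_const -[X in _ <= _ ^+ X]/(#|[pred i in V | Q i]|).
  case/andP: pm01 => h0 h1; apply: ler_wiXn2l => //.
  by apply: subset_leq_card; apply/fintype.subsetP => i; rewrite inE => /andP[].
case: (eqVneq j v) => [jv|jv] /=.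
  rewrite mul1r; apply: le_trans (H (fun i => i != j)) _.
  rewrite [leRHS](bigID (mem V)) /= [X in _ * X]big1 ?mulr1; last first.
    by move=> i /andP[_ /negPf iV]; rewrite /pot iV.
  rewrite le_eqVlt; apply/orP; left; apply/eqP; apply: eq_big => [i|i /andP[iV _]].
    by rewrite andbC.
  by rewrite /pot iV jV jv eqxx.
have /andP[pV pj] := prV jV jv.
rewrite (bigD1 (pr j)) //= {1}/pot pV jV jv eqxx /=.
apply: ler_wpM2l; first exact: edge_prob_ge0.
apply: le_trans (H (fun i => (i != j) && (i != pr j))) _.
rewrite [leRHS](bigID (mem V)) /= [X in _ * X]big1 ?mulr1; last first.
  by move=> i /andP[_ /negPf iV]; rewrite /pot iV.
rewrite le_eqVlt; apply/orP; left; apply/eqP; apply: eq_big => [i|i /and3P[iV _ ip]].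
  by rewrite andbC.
by rewrite /pot iV jV jv /= eq_sym (negPf ip).
Qed.

(** An outer vertex j with random label sees no inner vertex with probability at
    least 1 minus the sum of the edge probabilities, a bound in which the labels
    of the inner vertices no longer appear. *)
Let vertex_bound j : (if j \in V then q%:R^-1 * (1 - pm) ^+ #|V| else 1) *
    (if j \in V :\ v then prob (lab (pr j) == lab j) else 1) * (1 - #|I|%:R * dn)
  <= q%:R^-1 * \sum_l (lab_ok j l)%:R * vert j l.
Proof.
have dI : 0 <= 1 - #|I|%:R * dn <= 1.
  by rewrite subr_ge0 dn1 lerBlDr lerDl mulr_ge0.
case/andP: dI => dI0 dI1; case/andP: pm01 => h0 h1.
have qR : q%:R != 0 :> R by rewrite pnatr_eq0 -lt0n.
rewrite /lab_ok /vert in_setD1; case: (boolP (j \in V)) => jV /=.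
  rewrite andbT (bigD1 (lab j)) //= eqxx mul1r big1 ?addr0; last first.
    by move=> l /negPf ->; rewrite mul0r.
  rewrite -!mulrA ler_wpM2l ?invr_ge0 //.
  set y := (if _ then _ else _); have y0 : 0 <= y.
    by rewrite /y; case: ifP => _ //; exact: edge_prob_ge0.
  by rewrite [leLHS]mulrA [leRHS]mulrC ler_piMr // mulr_ge0 ?exprn_ge0.
rewrite andbF !mul1r.
apply: (@le_trans _ _ (q%:R^-1 * \sum_(l : 'I_q) (1 - \sum_(i in I) prob (lab i == l)))).
  rewrite big_split /= sumr_const card_ord sumrN exchange_big /=.
  rewrite mulrDr -mulr_natl mulr1 mulVf // lerD2l mulrN lerN2.
  rewrite -[leRHS](mulKf qR) ler_wpM2l ?invr_ge0 //.
  apply: (@le_trans _ _ (\sum_(i in I) q%:R * dn)).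
    by apply: ler_sum => i _; exact: pdn.
  by rewrite sumr_const -(mulr_natl _ #|I|) mulrCA lexx.
rewrite ler_wpM2l ?invr_ge0 //; apply: ler_sum => l _; rewrite mul1r.
by apply: bernoulli_prod => i; rewrite edge_prob_ge0 edge_prob_le1.
Qed.

(** For fixed labels the sum over graphs factorizes over pairs; after passing to
    the directed factors, the sum over labels factorizes over vertices. *)
Lemma emb_prob :
  (q%:R^-1) ^+ #|V| * (1 - pm) ^+ (#|V| * #|V|) * (1 - #|I|%:R * dn) ^+ n *
    \prod_(w in V :\ v) prob (lab (pr w) == lab w)
  <= \sum_(x | emb_ok x) sbm_pmf a b x.1 x.2.
Proof.
have -> : \sum_(x | emb_ok x) sbm_pmf a b x.1 x.2 =
    \sum_(s : {ffun 'I_n -> 'I_q}) \sum_(g : sgraph n)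
       (if emb_ok (g, s) then sbm_pmf a b g s else 0).
  by rewrite big_mkcond exchange_big pair_bigA; apply: eq_bigr => -[g s] _.
pose phi (s : {ffun 'I_n -> 'I_q}) i j (c : bool) : R :=
  if edge_ok i j c then if c then prob (s i == s j) else 1 - prob (s i == s j) else 0.
apply: (@le_trans _ _ (\sum_(s : {ffun 'I_n -> 'I_q}) \sum_(g : sgraph n)
   (q%:R^-1 ^+ n * (\prod_u (lab_ok u (s u))%:R) *
     \prod_(i < n) \prod_(j < n | (i < j)%N) phi s i j (sg_adj g i j)))); last first.
  apply: ler_sum => s _; apply: ler_sum => g _.
  case: ifPn => [/andP[/forallP lok /forallP eok]|].
    rewrite big1 ?mulr1; last first.
      by move=> u _; rewrite (_ : lab_ok u (s u) = true) //; exact: lok.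
    rewrite /sbm_pmf le_eqVlt; apply/orP; left; apply/eqP; congr (_ * _).
    apply: eq_bigr => i _; apply: eq_bigr => j ij.
    have ne : i != j by rewrite -(inj_eq val_inj) /= ltn_eqF.
    by have := forallP (eok i) j; rewrite ne /= /phi => ->.
  rewrite negb_and => /orP[/forallPn[u lu]|/forallPn[i /forallPn[j]]].
    by rewrite (bigD1 u) //= /lab_ok (negPf lu) mul0r mulr0 mul0r.
  rewrite negb_imply => /andP[ne eij].
  suff H (i' j' : 'I_n) : (i' < j')%N -> ~~ edge_ok i' j' (sg_adj g i' j') ->
      \prod_(i < n) \prod_(j < n | (i < j)%N) phi s i j (sg_adj g i j) = 0.
    move: ne; rewrite -(inj_eq val_inj) neq_ltn => /orP[] lt.
      by rewrite (H _ _ lt eij) mulr0.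
    by rewrite (H _ _ lt) ?mulr0 // edge_ok_sym sg_adj_sym.
  move=> lt /negPf e; rewrite (bigD1 i') //= (bigD1 j') //= {1}/phi e.
  by rewrite !mul0r.
apply: (@le_trans _ _ (\sum_(s : {ffun 'I_n -> 'I_q})
   (q%:R^-1 ^+ n * \prod_j ((lab_ok j (s j))%:R * vert j (s j))))); last first.
  apply: ler_sum => s _; rewrite -mulr_sumr sum_sgraph.
  rewrite -mulrA ler_wpM2l ?exprn_ge0 ?invr_ge0 // big_split /=.
  have [/forallP sl|/forallPn[u /negPf lu]] := boolP [forall u, lab_ok u (s u)]; last first.
    by rewrite (bigD1 u) //= lu !mul0r.
  rewrite ler_wpM2l ?prodr_ge0 //.
  apply: (@le_trans _ _ (\prod_(j < n) \prod_(i < n | i != j) pot s i j)).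
    apply: ler_prod => j _; rewrite (vert_pot s j) andbT /vert.
    case: ifP => _; last by apply: prodr_ge0 => i _; case/andP: (prob1 (lab i == s j)).
    case/andP: pm01 => h0 _; rewrite mulr_ge0 ?exprn_ge0 //.
    by case: ifP => _ //; exact: edge_prob_ge0.
  rewrite -prod_offdiag; apply: ler_prod => i _.
  rewrite prodr_ge0 /=; last first.
    by move=> j _; rewrite mulr_ge0 //; [case/andP: (pot01 s i j)|case/andP: (pot01 s j i)].
  apply: ler_prod => j ij; apply/andP; split.
    by rewrite mulr_ge0 //; [case/andP: (pot01 s i j)|case/andP: (pot01 s j i)].
  by apply: pot_weight => //; rewrite -(inj_eq val_inj) /= ltn_eqF.
rewrite -mulr_sumr -(bigA_distr_bigA (fun j l => (lab_ok j l)%:R * vert j l)).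
rewrite (_ : q%:R^-1 ^+ n = \prod_(j < n) q%:R^-1 :> R); last by rewrite prodr_const card_ord.
rewrite -big_split /=.
apply: (@le_trans _ _ (\prod_(j < n) ((if j \in V then q%:R^-1 * (1 - pm) ^+ #|V| else 1) *
    (if j \in V :\ v then prob (lab (pr j) == lab j) else 1) * (1 - #|I|%:R * dn)))).
  rewrite !big_split /= -!big_mkcond /= !prodr_const card_ord exprMn -exprM.
  by rewrite mulrAC.
apply: ler_prod => j _; rewrite vertex_bound andbT.
case/andP: pm01 => h0 _.
rewrite !mulr_ge0 //; last by rewrite subr_ge0.
  by case: ifP => _ //; rewrite mulr_ge0 ?invr_ge0 ?exprn_ge0.
by case: ifP => _ //; exact: edge_prob_ge0.
Qed.

End Embedding.
End SBM.

(** * Exploring a ball of a graph as a tree *)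

Section Dist.
Local Close Scope ring_scope.
Variables (n : nat) (g : sgraph n) (v : 'I_n).

Lemma dist_le0 z : dist_le g v z 0 <-> z = v.
Proof.
split; last by move=> ->; exists [::].
by move=> [p [_ <-]]; rewrite leqn0 size_eq0 => /eqP ->.
Qed.

Lemma dist_leS z j : dist_le g v z j.+1 <->
  dist_le g v z j \/ exists2 y, dist_le g v y j & sg_adj g y z.
Proof.
split.
  move=> [p [pp lp]]; rewrite leq_eqVlt => /predU1P[sp|sp]; last by left; exists p.
  right; case/lastP: p pp lp sp => // p y.
  rewrite rcons_path last_rcons size_rcons => /andP[pp yl] <- [sp].
  by exists (last v p) => //; exists p; rewrite sp.
move=> [[p [pp lp sp]]|[y [p [pp lp sp]] yz]]; first by exists p; split => //; exact: ltnW.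
by exists (rcons p z); rewrite rcons_path last_rcons size_rcons pp lp.
Qed.

End Dist.

Section Parents.
Local Close Scope ring_scope.
Variable q : nat.
Implicit Types u w : word q.

Definition parent w : word q := take (size w).-1 w.

Lemma parent_rcons u c : parent (rcons u c) = u.
Proof. by rewrite /parent size_rcons -cats1 take_size_cat. Qed.

Lemma is_childP u w : reflect (exists c, w = rcons u c) (is_child u w).
Proof.
apply: (iffP andP) => [[/prefixP[s ->]]|[c ->]].
  rewrite size_cat => /eqP; rewrite -addn1 => /addnI.
  by case: s => [|c []] // _; exists c; rewrite cats1.
by rewrite prefix_rcons size_rcons.
Qed.

Lemma is_child_size u w : is_child u w -> size w = (size u).+1.
Proof. by case/andP => _ /eqP. Qed.

End Parents.

Section Decode.
Local Close Scope ring_scope.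
Variables (n q : nat) (v : 'I_n).
Implicit Types (x : sgraph n * {ffun 'I_n -> 'I_q}) (u w : word q).

(** For y at distance j from v, these are the children of y with label i in the
    exploration of the graph from v; [enum] lists them in increasing order. *)
Definition fresh_nbrs x y j i : seq 'I_n :=
  [seq z <- enum 'I_n | [&& sg_adj x.1 y z, x.2 z == i & ~~ `[< dist_le x.1 v z j >]]].

(** The second component of the accumulator is the depth reached, which is the
    distance from v when the ball is a tree. *)
Definition read_word x u : 'I_n :=
  (foldl (fun st c => (nth v (fresh_nbrs x st.1 st.2 c.1) c.2, st.2.+1)) (v, 0%N) u).1.

(** The tree unfolded by exploring the graph from v by increasing distance.  It is
    defined for all graphs, but when the ball contains a cycle a vertex may be
    read along several words. *)
Definition ball_tree x : ltree q :=
  LTree (x.2 v) (fun u i => size (fresh_nbrs x (read_word x u) (size u) i)).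

Lemma read_word_rcons x u c :
  read_word x (rcons u c) = nth v (fresh_nbrs x (read_word x u) (size u) c.1) c.2.
Proof.
rewrite /read_word foldl_rcons /=; congr (nth _ (fresh_nbrs _ _ _ _) _).
suff H st : (foldl (fun st c => (nth v (fresh_nbrs x st.1 st.2 c.1) c.2, st.2.+1)) st u).2 =
   (st.2 + size u)%N by rewrite H.
by elim: u st => [|c' u IH] st /=; rewrite ?addn0 // IH /= addSnnS.
Qed.

End Decode.

Section Embed.
Local Close Scope ring_scope.
Variables (n q : nat) (v : 'I_n) (t : ltree q) (r : nat).
Variable B : word q -> 'I_q -> seq 'I_n.
Implicit Types (x : sgraph n * {ffun 'I_n -> 'I_q}) (u w : word q).

(** The last letter is read off with [rev], because the place of a child depends
    on its block and its rank only. *)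
Definition emb u : 'I_n :=
  if rev u is c :: u' then nth v (B (rev u') c.1) c.2 else v.

Lemma emb_rcons u c : emb (rcons u c) = nth v (B u c.1) c.2.
Proof. by rewrite /emb rev_rcons revK. Qed.

Hypothesis Bsize : forall u i, (u, i) \in blocks t r -> size (B u i) = lt_offspring t u i.
Hypothesis Bsort : forall u i, (u, i) \in blocks t r ->
  B u i = [seq z <- enum 'I_n | z \in B u i].
Hypothesis Buniq : uniq (v :: flatten [seq B c.1 c.2 | c <- blocks t r]).

Lemma perm_emb :
  perm_eq (map emb (verts t r)) (v :: flatten [seq B c.1 c.2 | c <- blocks t r]).
Proof.
rewrite (perm_trans (perm_map emb (perm_verts t r))) //= map_flatten -map_comp.
rewrite (_ : [seq _ | _ <- _] = [seq B c.1 c.2 | c <- blocks t r]) //.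
apply/eq_in_map => -[u i] ui /=; rewrite /block_verts -map_comp /= -(Bsize ui).
rewrite -[RHS](mkseq_nth v); apply: eq_map => k /=.
by rewrite emb_rcons.
Qed.

Lemma uniq_emb : uniq (map emb (verts t r)).
Proof. by rewrite (perm_uniq perm_emb). Qed.

Lemma emb_inj : {in verts t r &, injective emb}.
Proof.
move=> u w uV wV e; apply/eqP.
rewrite -(nth_index [::] uV) -(nth_index [::] wV) nth_uniq ?index_mem ?uniq_verts //.
rewrite -(nth_uniq v _ _ uniq_emb) ?size_map ?index_mem //.
by rewrite !(nth_map [::]) ?index_mem // !nth_index // e.
Qed.

Definition emb_word (y : 'I_n) : word q := nth [::] (verts t r) (index y (map emb (verts t r))).

Lemma emb_wordK u : u \in verts t r -> emb_word (emb u) = u.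
Proof.
move=> uV; rewrite /emb_word -{1}(nth_index [::] uV) -(nth_map [::] v) ?index_mem //.
by rewrite index_uniq ?size_map ?index_mem // ?uniq_emb // nth_index.
Qed.

Definition embV : {set 'I_n} := [set y in map emb (verts t r)].
Definition embI : {set 'I_n} := [set y in map emb (inner t r)].
Definition emb_par y := emb (parent (emb_word y)).
Definition emb_lab y := word_label (lt_root_label t) (emb_word y).

Lemma emb_in u : u \in verts t r -> emb u \in embV.
Proof. by move=> uV; rewrite inE map_f. Qed.

Lemma embVP y : y \in embV -> exists2 u, u \in verts t r & y = emb u.
Proof. by rewrite inE => /mapP. Qed.

Lemma nil_verts : [::] \in verts t r.
Proof. by apply/mem_verts; split => //; exact: in_ltree0. Qed.

Lemma card_embV : #|embV| = size (verts t r).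
Proof. by rewrite cardsE -(size_map emb); apply/card_uniqP; exact: uniq_emb. Qed.

Lemma card_embI : (#|embI| <= size (inner t r))%N.
Proof. by rewrite cardsE -(size_map emb); exact: card_size. Qed.

Lemma embIV : embI \subset embV.
Proof.
apply/fintype.subsetP => y; rewrite inE => /mapP[u + ->].
by rewrite mem_filter => /andP[_ uV]; exact: emb_in.
Qed.

Lemma emb_parP y : y \in embV -> y != v -> (emb_par y \in embV) && (emb_par y != y).
Proof.
move=> /embVP[u uV ->]; case/lastP: u uV => [|u c] uV; first by rewrite eqxx.
move=> _; rewrite /emb_par emb_wordK // parent_rcons.
have uV' := verts_prefix uV; rewrite emb_in //=; apply/eqP => /emb_inj-/(_ uV' uV).
by move/(congr1 size); rewrite size_rcons => /eqP; rewrite eqn_leq ltnn andbF.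
Qed.

Section Event.
Variable x : sgraph n * {ffun 'I_n -> 'I_q}.
Hypothesis xok : emb_ok embV embI v emb_par emb_lab x.

Lemma emb_ok_lab u : u \in verts t r -> x.2 (emb u) = word_label (lt_root_label t) u.
Proof.
move=> uV; case/andP: xok => /forall_inP/(_ _ (emb_in uV))/eqP -> _.
by rewrite /emb_lab emb_wordK.
Qed.

Lemma emb_eq u w : u \in verts t r -> w \in verts t r -> (emb u == emb w) = (u == w).
Proof. by move=> uV wV; apply/eqP/eqP => [/emb_inj->//|->]. Qed.

Lemma emb_is_child u w : u \in verts t r -> w \in verts t r ->
  (emb w != v) && (emb_par (emb w) == emb u) = is_child u w.
Proof.
move=> uV wV; rewrite /emb_par emb_wordK // -[X in _ != X]/(emb [::]) (emb_eq wV nil_verts).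
case/lastP: w wV => [|w c] wV.
  by rewrite eqxx /=; apply/esym/negP => /is_child_size.
rewrite parent_rcons (emb_eq (verts_prefix wV) uV) -size_eq0 size_rcons /=.
apply/eqP/is_childP => [->|[c' /rcons_inj[]] //]; by exists c.
Qed.

Lemma emb_ok_adj u w : u \in verts t r -> w \in verts t r ->
  sg_adj x.1 (emb u) (emb w) = is_child u w || is_child w u.
Proof.
move=> uV wV; have [<-|ne] := eqVneq u w.
  rewrite sg_adj_irr orbb; apply/esym/negP => /is_child_size/eqP.
  by rewrite eqn_leq ltnn andbF.
case/andP: xok => _ /forallP/(_ (emb u))/forallP/(_ (emb w)).
rewrite emb_eq // ne /= /edge_ok !emb_in //= => /eqP ->.
by rewrite /tree_adj !emb_is_child.
Qed.

Lemma emb_ok_out u z : u \in verts t r -> (size u < r)%N -> sg_adj x.1 (emb u) z ->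
  exists2 w, w \in verts t r & z = emb w.
Proof.
move=> uV ur; have [/embVP//|zV] := boolP (z \in embV).
case/andP: xok => _ /forallP/(_ (emb u))/forallP/(_ z).
have ne : emb u != z by apply: contraNneq zV => <-; exact: emb_in.
rewrite ne /edge_ok (negPf zV) andbF andbT.
have -> : emb u \in embI by rewrite inE map_f // mem_filter ur uV.
by move=> /= /negPf ->.
Qed.

(** A vertex at distance j + 1 <= r is a neighbour of a vertex of depth less than
    r, so it is placed, and it is the image of a child or of the parent. *)
Lemma emb_ok_dist j z : (j <= r)%N -> dist_le x.1 v z j <->
  exists u, [/\ u \in verts t r, (size u <= j)%N & z = emb u].
Proof.
elim: j z => [|j IH] z jr.
  split; first by move=> /dist_le0 ->; exists [::]; split => //; exact: nil_verts.
  by move=> [u [_ + ->]]; rewrite leqn0 size_eq0 => /eqP ->; apply/dist_le0.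
have {}IH z' := IH z' (ltnW jr); split.
  move=> /dist_leS[/IH[u [uV uj ->]]|[y /IH[u [uV uj ->]] uz]].
    by exists u; split => //; exact: leq_trans uj _.
  have [w wV zw] := emb_ok_out uV (leq_ltn_trans uj jr) uz.
  exists w; split => //; move: uz; rewrite zw emb_ok_adj // => /orP[] /is_child_size.
    by move=> ->.
  by move=> e; apply: leq_trans (leq_trans uj _) => //; rewrite e.
move=> [u [uV + ->]]; case/lastP: u uV => [|u c] uV.
  by move=> _; apply/dist_leS; left; apply/IH; exists [::]; split => //; exact: nil_verts.
rewrite size_rcons ltnS => uj; have uV' := verts_prefix uV.
apply/dist_leS; right; exists (emb u); first by apply/IH; exists u.
by rewrite emb_ok_adj //; apply/orP; left; apply/is_childP; exists c.
Qed.

Lemma emb_ok_isom : rl_isom (sg_ball x.1 x.2 v r) (ltree_trunc t r).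
Proof.
have D z : dist_le x.1 v z r -> exists2 u, u \in verts t r & z = emb u.
  by move=> /(emb_ok_dist _ (leqnn r))[u [uV _ ->]]; exists u.
exists emb_word; split.
- split.
  + by move=> z /= /D[u uV ->]; rewrite emb_wordK //; exact/mem_verts.
  + move=> y z; rewrite !inE /= => /D[u uV ->] /D[w wV ->].
    by rewrite !emb_wordK // => ->.
  + move=> w /= /mem_verts wV; exists (emb w); last exact: emb_wordK.
    by apply/emb_ok_dist => //; exists w; split => //; case/mem_verts: wV.
- by rewrite /= -[v]/(emb [::]) emb_wordK //; exact: nil_verts.
- by move=> y z /= /D[u uV ->] /D[w wV ->]; rewrite !emb_wordK // emb_ok_adj.
- by move=> y /= /D[u uV ->]; rewrite emb_wordK // emb_ok_lab.
Qed.

(** The fresh neighbours of the image of u are the images of its children, its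
    parent being closer to v.  As both lists are increasing they are equal; this
    is why a ball determines the tree and its increasing placement. *)
Lemma emb_ok_fresh_nbrs u i : u \in verts t r -> (size u < r)%N ->
  fresh_nbrs v x (emb u) (size u) i = B u i.
Proof.
move=> uV ur; have ub : (u, i) \in blocks t r by rewrite mem_blocks uV.
rewrite [RHS]Bsort //; apply: eq_filter => z; apply/and3P/idP.
  move=> [uz /eqP zi nd]; have [w wV zw] := emb_ok_out uV ur uz.
  move: uz zi nd; rewrite zw emb_ok_adj // emb_ok_lab // => /orP[|/is_child_size e].
    move=> /is_childP[[i' k] e]; rewrite e /word_label map_rcons last_rcons /= => <- _.
    move: wV; rewrite e => /verts_rcons[_ _ h]; rewrite emb_rcons /=.
    by apply: mem_nth; rewrite Bsize // mem_blocks uV.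
  move=> _ /asboolP[]; apply/emb_ok_dist; first exact: ltnW.
  by exists w; split => //; rewrite e.
move=> zB; pose k := index z (B u i).
have kV : rcons u (i, k) \in verts t r.
  by apply/verts_rcons; split => //; rewrite -Bsize // index_mem.
have -> : z = emb (rcons u (i, k)) by rewrite emb_rcons nth_index.
rewrite emb_ok_adj // emb_ok_lab // /word_label map_rcons last_rcons eqxx; split => //.
  by apply/orP; left; apply/is_childP; exists (i, k).
apply/asboolP => /emb_ok_dist[|w [wV wu /emb_inj-/(_ kV wV) e]]; first exact: ltnW.
by move: wu; rewrite -e size_rcons ltnn.
Qed.

Lemma emb_ok_read_word u : u \in verts t r -> read_word v x u = emb u.
Proof.
elim/last_ind: u => [//|u [i k] IH uV]; rewrite read_word_rcons emb_rcons /=.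
have [uV' ur _] := (verts_rcons _ _ _ _ _).1 uV.
by rewrite IH // emb_ok_fresh_nbrs.
Qed.

Lemma emb_ok_code : tree_code r t = tree_code r (ball_tree v x).
Proof.
apply: eq_code => /=; first by rewrite -[v]/(emb [::]) emb_ok_lab //; exact: nil_verts.
move=> u i ui; have := ui; rewrite mem_blocks => /andP[uV ur].
by rewrite emb_ok_read_word // emb_ok_fresh_nbrs // Bsize.
Qed.

Lemma emb_ok_blocks u i : (u, i) \in blocks t r -> B u i = fresh_nbrs v x (read_word v x u) (size u) i.
Proof. by rewrite mem_blocks => /andP[uV ur]; rewrite emb_ok_read_word // emb_ok_fresh_nbrs. Qed.

End Event.
End Embed.

(** * Comparing the likelihoods of a tree and of a ball *)

Section Draws.
Variable T : finType.
Implicit Types (A Y : {set T}) (ks : seq nat) (Ss : seq {set T}).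

(** Families of pairwise disjoint subsets of A with prescribed sizes.  For the
    sizes of the blocks of a tree, these are the placements that are increasing
    on each block. *)
Fixpoint draws ks A : seq (seq {set T}) :=
  if ks is k :: ks' then
    [seq Y :: Ss | Y <- enum [set Y : {set T} | (Y \subset A) && (#|Y| == k)]%SET,
                   Ss <- draws ks' (A :\: Y)]
  else [:: [::]].

Lemma draws_uniq ks A : uniq (draws ks A).
Proof.
elim: ks A => //= k ks IH A; apply: allpairs_uniq_dep; first exact: enum_uniq.
  by move=> Y _; exact: IH.
by move=> [Y Ss] [Y' Ss'] _ _ /= [-> ->].
Qed.

Lemma drawsP ks A Ss : Ss \in draws ks A ->
  [/\ [seq #|Y| | Y : {set T} <- Ss] = ks,
      uniq (flatten [seq enum Y | Y : {set T} <- Ss])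
    & {subset flatten [seq enum Y | Y : {set T} <- Ss] <= A}].
Proof.
elim: ks A Ss => [|k ks IH] A Ss /=; first by rewrite inE => /eqP ->.
move=> /allpairsPdep[Y [Ss' [+ /IH[h1 h2 h3] ->]]].
rewrite mem_enum inE => /andP[SA /eqP cS]; split => /=.
- by rewrite cS h1.
- rewrite cat_uniq enum_uniq h2 andbT; apply/hasPn => z /h3.
  by rewrite inE mem_enum => /andP[].
- move=> z; rewrite mem_cat mem_enum => /orP[/(fintype.subsetP SA)//|/h3].
  by rewrite inE => /andP[].
Qed.

Lemma ffactD n k m : (n ^_ (k + m) = n ^_ k * (n - k) ^_ m)%N.
Proof.
elim: k n => [|k IH] n; first by rewrite subn0 mul1n.
rewrite addSn !ffactnS IH mulnA; congr (_ * _ ^_ _)%N.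
by case: n => //; rewrite sub0n.
Qed.

(** Ordering every member of a family gives an injective sequence in A, and each
    sequence arises once; the induction is n ^_ (k + m) = n ^_ k * (n - k) ^_ m. *)
Lemma size_draws ks A :
  (size (draws ks A) * \prod_(k <- ks) k`! = #|A| ^_ (sumn ks))%N.
Proof.
elim: ks A => [|k ks IH] A; first by rewrite big_nil.
rewrite /= size_allpairs_dep big_cons sumnE big_map big_enum /=.
rewrite mulnCA big_distrl /= (eq_bigr (fun=> (#|A| - k) ^_ (sumn ks))%N); last first.
  move=> Y; rewrite inE => /andP[SA /eqP cS].
  by rewrite IH cardsD (finset.setIidPr SA) cS.
by rewrite sum_nat_const cards_draws mulnA [X in (X * _)%N]mulnC bin_ffact ffactD.
Qed.

End Draws.

Section Bernoulli.
Context {R : realType}.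

Lemma bernoulli_exp (x : R) k : 0 <= x <= 1 -> 1 - k%:R * x <= (1 - x) ^+ k.
Proof.
move=> x01; have := @bernoulli_prod R _ (index_enum 'I_k) xpredT (fun=> x) (fun=> x01).
by rewrite sumr_const prodr_const card_ord mulr_natl.
Qed.

Lemma ffact_lower n m k : (m <= n)%N -> (k < m)%N ->
  n%:R ^+ k * (1 - m%:R ^+ 2 / n%:R) <= (n.-1 ^_ k)%:R :> R.
Proof.
move=> mn km; have n0 : (0 < n)%N by exact: leq_trans (leq_trans (ltn0Sn k) km) mn.
have nR : 0 < n%:R :> R by rewrite ltr0n.
apply: (@le_trans _ _ (n%:R ^+ k * (1 - m%:R / n%:R) ^+ k)).
  rewrite ler_wpM2l ?exprn_ge0 //.
  have x01 : 0 <= (m%:R / n%:R : R) <= 1.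
    by rewrite divr_ge0 //= ler_pdivrMr // mul1r ler_nat.
  apply: le_trans (bernoulli_exp k x01).
  rewrite lerD2l lerN2 mulrA ler_wpM2r ?invr_ge0 // expr2 -!natrM ler_nat.
  by rewrite leq_mul2r ltnW ?orbT.
rewrite -exprMn mulrBr mulr1 mulrCA divff ?gt_eqF // mulr1 -natrB //.
rewrite ffact_prod natr_prod -[X in _ ^+ X](card_ord k) -prodr_const.
apply: ler_prod => i _; rewrite ler0n ler_nat /=.
have := ltn_ord i; lia.
Qed.

(** From exp y >= 1 + y one gets 1 - y >= exp (- y) (1 - y ^ 2); then apply
    Bernoulli's inequality to the second factor. *)
Lemma exp_lower (y : R) n : 0 <= y -> y <= 1 ->
  expR (- (n%:R * y)) * (1 - n%:R * y ^+ 2) <= (1 - y) ^+ n.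
Proof.
move=> y0 y1; rewrite -mulrN expRM_natl.
apply: (@le_trans _ _ ((expR (- y)) ^+ n * (1 - y ^+ 2) ^+ n)).
  rewrite ler_wpM2l ?exprn_ge0 ?expR_ge0 //; apply: (bernoulli_exp n).
  by rewrite exprn_ge0 //= exprn_ile1.
rewrite -exprMn; apply: lerXn2r.
- by rewrite nnegrE mulr_ge0 ?expR_ge0 // subr_ge0 exprn_ile1.
- by rewrite nnegrE subr_ge0.
rewrite (_ : 1 - y ^+ 2 = (1 + y) * (1 - y)); last by ring.
rewrite mulrA ler_piMl ?subr_ge0 //.
apply: (@le_trans _ _ (expR (- y) * expR y)); last by rewrite -expRD addNr expR0.
by rewrite ler_wpM2l ?expR_ge0 // expR_ge1Dx.
Qed.

End Bernoulli.

Section Likelihood.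
Context {R : realType} (n q : nat) (a b : R) (v : 'I_n) (t : ltree q) (r : nat).
Hypotheses (q0 : (0 < q)%N) (a0 : 0 < a) (b0 : 0 < b).
Local Notation s0 := (lt_root_label t).
Local Notation bl := (blocks t r).
Local Notation m := (size (verts t r)).
Local Notation off c := (lt_offspring t c.1 c.2).
Local Notation prob := (@sbm_edge_prob R n a b).

Let rate (c : word q * 'I_q) : R := offspring_rate a b (word_label s0 c.1) c.2.

Definition draw_sets (Ss : seq {set 'I_n}) (u : word q) (i : 'I_q) : seq 'I_n :=
  enum (nth finset.set0 Ss (index (u, i) bl)).

Lemma flatten_draw_sets Ss : size Ss = size bl ->
  flatten [seq draw_sets Ss c.1 c.2 | c <- bl] =
  flatten [seq enum Y | Y : {set 'I_n} <- Ss].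
Proof.
move=> sS; congr flatten.
apply: (@eq_from_nth _ [::]); rewrite !size_map // => k kb.
have c0 : word q * 'I_q := ([::], s0).
rewrite (nth_map c0) // (nth_map finset.set0) ?sS //.
by rewrite /draw_sets -surjective_pairing index_uniq // uniq_blocks.
Qed.

Definition emb_event Ss (x : sgraph n * {ffun 'I_n -> 'I_q}) : bool :=
  emb_ok (embV v t r (draw_sets Ss)) (embI v t r (draw_sets Ss)) v
    (emb_par v t r (draw_sets Ss)) (emb_lab v t r (draw_sets Ss)) x.

(** The first conjunct is the isomorphism that is wanted; the second one makes
    these events disjoint for trees with different codes. *)
Definition ball_code_event (x : sgraph n * {ffun 'I_n -> 'I_q}) : bool :=
  `[< rl_isom (sg_ball x.1 x.2 v r) (ltree_trunc t r) >] &&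
  (tree_code r t == tree_code r (ball_tree v x)).

Let ks := [seq off c | c <- bl].
Let DD := draws ks (~: [set v]).

Lemma drawn_ok Ss : Ss \in DD ->
  [/\ forall u i, (u, i) \in bl -> size (draw_sets Ss u i) = lt_offspring t u i,
      forall u i, (u, i) \in bl ->
        draw_sets Ss u i = [seq z <- enum 'I_n | z \in draw_sets Ss u i],
      uniq (v :: flatten [seq draw_sets Ss c.1 c.2 | c <- bl])
    & size Ss = size bl].
Proof.
move=> /drawsP[h1 h2 h3].
have sS : size Ss = size bl by rewrite -(size_map (fun Y : {set 'I_n} => #|Y|)) h1 size_map.
split => //.
- move=> u i ui; rewrite /draw_sets -cardE.
  rewrite -(nth_map finset.set0 0%N (fun Y : {set 'I_n} => #|Y|)) ?sS ?index_mem // h1.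
  by rewrite (nth_map (u, i)) ?index_mem // nth_index.
- move=> u i ui; rewrite /draw_sets {1}/enum_mem -enumT; apply: eq_filter => z.
  by rewrite mem_enum.
- rewrite flatten_draw_sets //= h2 andbT; apply/negP => /h3.
  by rewrite !inE eqxx.
Qed.

Lemma emb_event_code Ss x : Ss \in DD -> emb_event Ss x -> ball_code_event x.
Proof.
move=> /drawn_ok[h1 h2 h3 _] e; apply/andP; split.
  by apply/asboolP; exact: emb_ok_isom e.
by apply/eqP; exact: emb_ok_code e.
Qed.

(** The graph determines the placement, by [emb_ok_blocks], so the events of
    distinct placements are disjoint. *)
Lemma emb_event_inj Ss Ss' x : Ss \in DD -> Ss' \in DD ->
  emb_event Ss x -> emb_event Ss' x -> Ss = Ss'.
Proof.
move=> /drawn_ok[h1 h2 h3 h4] /drawn_ok[h1' h2' h3' h4'] e e'.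
apply: (@eq_from_nth _ finset.set0); first by rewrite h4 h4'.
move=> k; rewrite h4 => kb.
have c0 : word q * 'I_q := ([::], s0).
pose c := nth c0 bl k.
have cb : (c.1, c.2) \in bl by rewrite -surjective_pairing mem_nth.
have ck : index (c.1, c.2) bl = k by rewrite -surjective_pairing index_uniq // uniq_blocks.
have := emb_ok_blocks h1 h2 h3 e cb; rewrite -(emb_ok_blocks h1' h2' h3' e' cb).
by rewrite /draw_sets ck => E; apply/setP => z; rewrite -mem_enum E mem_enum.
Qed.

Lemma sum_emb_event :
  \sum_(Ss <- DD) \sum_(x | emb_event Ss x) sbm_pmf a b x.1 x.2 <=
  \sum_(x | ball_code_event x) sbm_pmf a b x.1 x.2.
Proof.
rewrite (eq_bigr (fun Ss => \sum_x (if emb_event Ss x then sbm_pmf a b x.1 x.2 else 0)));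
  last by move=> Ss _; rewrite big_mkcond.
rewrite exchange_big /= [leRHS]big_mkcond /=; apply: ler_sum => x _.
have [/hasP[Ss SsD e]|/hasPn ne] := boolP (has (emb_event^~ x) DD).
  rewrite (bigD1_seq Ss) ?draws_uniq //= e (emb_event_code SsD e).
  rewrite big_seq_cond big1 ?addr0 // => Ss' /andP[SsD' nSs]; case: ifP => // e'.
  by rewrite (emb_event_inj SsD' SsD e' e) eqxx in nSs.
rewrite big_seq big1; first by case: ifP => // _; exact: sbm_pmf_ge0.
by move=> Ss /ne /negPf ->.
Qed.

Lemma emb_prod Ss : Ss \in DD ->
  \prod_(w in embV v t r (draw_sets Ss) :\ v)
    prob (emb_lab v t r (draw_sets Ss) (emb_par v t r (draw_sets Ss) w)
          == emb_lab v t r (draw_sets Ss) w) =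
  \prod_(c <- bl) prob (word_label s0 c.1 == c.2) ^+ off c.
Proof.
move=> /drawn_ok[h1 h2 h3 _].
pose L := flatten [seq draw_sets Ss c.1 c.2 | c <- bl].
have /andP[vL uL] : uniq (v :: L) by [].
transitivity (\prod_(w <- L) prob (emb_lab v t r (draw_sets Ss)
     (emb_par v t r (draw_sets Ss) w) == emb_lab v t r (draw_sets Ss) w)).
  rewrite [RHS]big_uniq //; apply: eq_bigl => w; rewrite finset.in_setD1 finset.in_set.
  rewrite (perm_mem (perm_emb v h1)) in_cons -/L; case: eqP => // ->.
  by rewrite (negPf vL).
rewrite /L big_flatten big_map /= big_seq [RHS]big_seq.
apply: eq_bigr => -[u i] ui /=; rewrite -(h1 _ _ ui).
rewrite big_seq (eq_bigr (fun=> prob (word_label s0 u == i))); last first.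
  move=> w wB; pose k := index w (draw_sets Ss u i).
  have uV : rcons u (i, k) \in verts t r.
    have := ui; rewrite mem_blocks => /andP[h4 h5]; apply/verts_rcons; split => //.
    by rewrite -(h1 _ _ ui) index_mem.
  have -> : w = emb v (draw_sets Ss) (rcons u (i, k)) by rewrite emb_rcons nth_index.
  rewrite /emb_par /emb_lab (emb_wordK h1 h3 uV) parent_rcons.
  rewrite (emb_wordK h1 h3 (verts_prefix uV)).
  by rewrite [in X in _ == X]/word_label map_rcons last_rcons.
by rewrite -big_seq big_const_seq count_predT iter_mulr_1.
Qed.

Let dd : R := \sum_i offspring_rate a b s0 i.

Lemma offspring_rate_sum_const (l : 'I_q) : \sum_i offspring_rate a b l i = dd :> R.
Proof.
have E (k : 'I_q) : \sum_i offspring_rate a b k i = (a + b *+ q.-1) / q%:R :> R.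
  rewrite /offspring_rate -mulr_suml (bigD1 k) //= eqxx; congr ((_ + _) / _).
  rewrite (eq_bigr (fun=> b)); last by move=> i; rewrite eq_sym => /negPf ->.
  rewrite sumr_const; congr (_ *+ _).
  by have := cardC1 k; rewrite card_ord => <-; apply: eq_card => i; rewrite !inE.
by rewrite E /dd E.
Qed.

Definition tree_pmf : R := q%:R^-1 * \prod_(c <- bl) poisson_pmf (rate c) (off c).

Definition ball_err : R := (1 + (a + b) + (a + b) ^+ 2) * (m%:R ^+ 2 / n%:R).

Lemma tree_pmf_ge0 : 0 <= tree_pmf.
Proof.
rewrite mulr_ge0 ?invr_ge0 // big_seq; apply: prodr_ge0 => c _; exact: poisson_pmf_ge0.
Qed.

(** The factors q, n, the rates and the factorials of the two likelihoods cancel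
    exactly.  What remains are the falling factorial against n ^ (m - 1), the
    missing edges inside the tree, and (1 - d i / n) ^ n against exp (- d i):
    the three terms of [ball_err]. *)
Lemma likelihood :
  (1 - ball_err) * tree_pmf <= \sum_(x | ball_code_event x) sbm_pmf a b x.1 x.2.
Proof.
have qR : 0 < q%:R :> R by rewrite ltr0n.
have n0 : (0 < n)%N by case: (v) => k; case: n.
have nR : 0 < n%:R :> R by rewrite ltr0n.
(* If the error exceeds 1 the bound is trivial; otherwise it yields all the
   smallness needed below: m <= n, edge probabilities a / n and b / n at most
   1, and i * d / n <= 1. *)
have [e1|e1] := ltP 1 ball_err.
  apply: (@le_trans _ _ 0); last by apply: sumr_ge0 => x _; exact: sbm_pmf_ge0.
  by rewrite mulr_le0_ge0 ?tree_pmf_ge0 // subr_le0 ltW.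
have m1 : (1 <= m)%N by rewrite size_verts.
have m1R : 1 <= m%:R :> R by rewrite ler1n.
pose z : R := m%:R ^+ 2 / n%:R.
have z0 : 0 <= z by rewrite divr_ge0 ?exprn_ge0.
pose D := a + b.
have D0 : 0 < D by rewrite addr_gt0.
have e1' : (1 + D + D ^+ 2) * z <= 1 by exact: e1.
have Dz0 : 0 <= D * z by rewrite mulr_ge0 // ltW.
have DDz0 : 0 <= D ^+ 2 * z by rewrite mulr_ge0 // exprn_ge0 // ltW.
have z1 : z <= 1 by nra.
have Dz1 : D * z <= 1 by nra.
have DDz1 : D ^+ 2 * z <= 1 by nra.
have mz : m%:R / n%:R <= z.
  by rewrite /z ler_wpM2r ?invr_ge0 // expr2 ler_peMl.
have nz : n%:R^-1 <= z.
  by apply: le_trans mz; rewrite ler_peMl ?invr_ge0.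
have mn : (m <= n)%N.
  rewrite -(ler_nat R) -[leRHS]mul1r -ler_pdivrMr //; exact: le_trans mz z1.
pose pm := D / n%:R.
have pmz : pm <= D * z by rewrite /pm ler_wpM2l // ltW.
have pm1 : pm <= 1 by exact: le_trans pmz Dz1.
have pm0 : 0 <= pm by rewrite divr_ge0 // ltW.
have probE s : prob s = (if s then a else b) / n%:R.
  rewrite /sbm_edge_prob min_r //; apply: le_trans pm1.
  by rewrite ler_wpM2r ?invr_ge0 //; case: s; rewrite /D ?lerDl ?lerDr ltW.
have ppm s : prob s <= pm.
  rewrite probE ler_wpM2r ?invr_ge0 //.
  by case: s; rewrite /D ?lerDl ?lerDr ltW.
have probr (l i : 'I_q) : prob (l == i) = q%:R * offspring_rate a b l i / n%:R.
  by rewrite probE /offspring_rate; field; rewrite !gt_eqF.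
have dd0 : 0 <= dd.
  by apply: sumr_ge0 => i _; rewrite divr_ge0 //; case: ifP => _; exact: ltW.
have ddD : dd <= D by exact: offspring_rate_sum_le.
pose dn := dd / n%:R.
have dn0 : 0 <= dn by rewrite divr_ge0.
have pdn (l : 'I_q) : \sum_(l' : 'I_q) prob (l == l') <= q%:R * dn.
  rewrite (eq_bigr (fun l' => q%:R / n%:R * offspring_rate a b l l')); last first.
    by move=> l' _; rewrite probr mulrAC.
  by rewrite -mulr_sumr offspring_rate_sum_const /dn mulrAC mulrA mulrAC.
pose mi := size (inner t r).
have mim : (mi <= m)%N by exact: size_inner_le.
have midd : mi%:R * dd <= m%:R * D by rewrite ler_pM // ler_nat.
have mm0 : 0 <= mi%:R * dd by rewrite mulr_ge0.
have midn : mi%:R * dn <= 1.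
  apply: le_trans Dz1; rewrite /dn mulrA.
  apply: (@le_trans _ _ (D * (m%:R / n%:R))).
    by rewrite mulrA ler_wpM2r ?invr_ge0 // [leRHS]mulrC.
  by rewrite ler_wpM2l // ltW.
have LB Ss : Ss \in DD ->
  (q%:R^-1) ^+ m * (1 - pm) ^+ (m * m) * (1 - mi%:R * dn) ^+ n *
    \prod_(c <- bl) prob (word_label s0 c.1 == c.2) ^+ off c
  <= \sum_(x | emb_event Ss x) sbm_pmf a b x.1 x.2.
  move=> SsD; have [h1 h2 h3 _] := drawn_ok SsD.
  have cI : #|embI v t r (draw_sets Ss)|%:R * dn <= mi%:R * dn.
    by rewrite ler_wpM2r // ler_nat card_embI.
  have := emb_prob q0 a0 b0 (emb_lab v t r (draw_sets Ss)) (embIV v t r (draw_sets Ss))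
    (emb_parP h1 h3) pm1 ppm pdn (le_trans cI midn) dn0.
  rewrite card_embV // emb_prod //; apply: le_trans.
  rewrite ler_wpM2r //.
    by apply: prodr_ge0 => c _; rewrite exprn_ge0 // edge_prob_ge0.
  rewrite ler_wpM2l ?mulr_ge0 ?exprn_ge0 ?invr_ge0 ?subr_ge0 //.
  apply: lerXn2r; rewrite ?nnegrE ?subr_ge0 //; first exact: le_trans cI midn.
  by rewrite lerD2l lerN2.
pose LBv := (q%:R^-1) ^+ m * (1 - pm) ^+ (m * m) * (1 - mi%:R * dn) ^+ n *
    \prod_(c <- bl) prob (word_label s0 c.1 == c.2) ^+ off c.
suff main : (1 - ball_err) * tree_pmf <= (size DD)%:R * LBv.
  apply: le_trans main (le_trans _ sum_emb_event).
  rewrite big_seq; apply: (@le_trans _ _ (\sum_(Ss <- DD | Ss \in DD) LBv)).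
    by rewrite -big_seq big_const_seq count_predT iter_addr_0 mulr_natl.
  by apply: ler_sum => Ss SsD; exact: LB.
pose K := (\sum_(c <- bl) off c)%N.
have mK : m = K.+1 by rewrite size_verts.
pose PP : R := \prod_(c <- bl) rate c ^+ off c.
pose FF : R := \prod_(c <- bl) (off c)`!%:R.
have rate0 c : 0 < rate c by exact: offspring_rate_gt0.
have PP0 : 0 <= PP by apply: prodr_ge0 => c _; rewrite exprn_ge0 // ltW.
have FF0 : 0 < FF by apply: prodr_gt0 => c _; rewrite ltr0n fact_gt0.
have szD : (size DD)%:R * FF = (n.-1 ^_ K)%:R.
  have := size_draws ks (~: [set v]); rewrite cardsC1 card_ord sumnE !big_map -/K.
  by move=> /(congr1 (fun k => k%:R : R)); rewrite natrM natr_prod.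
have probP : \prod_(c <- bl) prob (word_label s0 c.1 == c.2) ^+ off c =
   (q%:R / n%:R) ^+ K * PP.
  rewrite -prodrXr -big_split /=; apply: eq_bigr => c _.
  by rewrite probr mulrAC exprMn.
pose E := expR (- (mi%:R * dd)).
have E0 : 0 <= E by exact: expR_ge0.
have treeE : tree_pmf = q%:R^-1 * (PP / FF * E).
  rewrite /tree_pmf; congr (_ * _).
  rewrite (eq_bigr (fun c => rate c ^+ off c * (off c)`!%:R^-1 * expR (- rate c))); last first.
    by move=> c _; rewrite /poisson_pmf rate0.
  rewrite !big_split /= -prodfV; congr (_ * _ * _).
  rewrite -expR_sum /E sumrN; congr (expR (- _)).
  rewrite /blocks big_allpairs_dep /= (eq_bigr (fun=> dd)); last first.
    by move=> u _; rewrite big_enum /=; exact: offspring_rate_sum_const.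
  by rewrite big_const_seq count_predT iter_addr_0 mulr_natl.
have P1 : 1 - D * z <= (1 - pm) ^+ (m * m).
  have := @bernoulli_exp R pm (m * m)%N; rewrite pm0 pm1 => /(_ isT).
  by rewrite /pm natrM -expr2 mulrCA.
have P2 : E * (1 - D ^+ 2 * z) <= (1 - mi%:R * dn) ^+ n.
  have md0 : 0 <= mi%:R * dn by rewrite mulr_ge0.
  have := exp_lower n md0 midn.
  have -> : n%:R * (mi%:R * dn) = mi%:R * dd.
    by rewrite /dn; field; rewrite gt_eqF.
  apply: le_trans; rewrite ler_wpM2l // lerD2l lerN2.
  have -> : n%:R * (mi%:R * dn) ^+ 2 = (mi%:R * dd) ^+ 2 / n%:R.
    by rewrite /dn; field; rewrite gt_eqF.
  rewrite /z mulrA ler_wpM2r ?invr_ge0 // -exprMn.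
  by apply: lerXn2r; rewrite ?nnegrE ?mulr_ge0 ?(ltW D0) // [leRHS]mulrC.
have FFl : n%:R ^+ K * (1 - z) <= (size DD)%:R * FF.
  by rewrite szD; apply: ffact_lower; rewrite // mK.
have -> : (size DD)%:R * LBv = q%:R^-1 * PP / FF * ((size DD)%:R * FF / n%:R ^+ K) *
   (1 - pm) ^+ (m * m) * (1 - mi%:R * dn) ^+ n.
  rewrite /LBv probP mK exprS expr_div_n exprVn.
  field; rewrite ?expf_neq0 ?gt_eqF //.
have F1 : 1 - z <= (size DD)%:R * FF / n%:R ^+ K.
  by rewrite ler_pdivlMr ?exprn_gt0 // mulrC.
rewrite treeE.
apply: (@le_trans _ _ (q%:R^-1 * PP / FF *
    ((1 - z) * (1 - D * z) * (E * (1 - D ^+ 2 * z))))).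
  rewrite (_ : _ * (q%:R^-1 * _) = q%:R^-1 * PP / FF * ((1 - ball_err) * E)); last by ring.
  rewrite ler_wpM2l ?divr_ge0 ?mulr_ge0 ?invr_ge0 ?(ltW FF0) //.
  rewrite (_ : _ * (E * _) = (1 - z) * (1 - D * z) * (1 - D ^+ 2 * z) * E); last by ring.
  rewrite ler_wpM2r // (_ : ball_err = z + D * z + D ^+ 2 * z); last first.
    by rewrite /ball_err -/z -/D; ring.
  rewrite -subr_ge0.
  set x := D * z in Dz0 Dz1 *; set y := D ^+ 2 * z in DDz0 DDz1 *.
  rewrite (_ : _ - _ = z * x + y * z + x * y * (1 - z)); last by ring.
  apply: addr_ge0; first by apply: addr_ge0; apply: mulr_ge0.
  by apply: mulr_ge0; [exact: mulr_ge0|rewrite subr_ge0].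
rewrite [leRHS](_ : _ = q%:R^-1 * PP / FF * ((size DD)%:R * FF / n%:R ^+ K *
   (1 - pm) ^+ (m * m) * (1 - mi%:R * dn) ^+ n)); last by rewrite !mulrA.
rewrite ler_wpM2l ?divr_ge0 ?mulr_ge0 ?invr_ge0 ?(ltW FF0) //.
apply: ler_pM => //; rewrite ?mulr_ge0 ?subr_ge0 //.
by rewrite ler_pM // ?subr_ge0.
Qed.

End Likelihood.

(** * Couplings from joint probability masses *)

Section Sample.
Context {R : realType} (X : finType) (x0 : X) (K : X -> R).
Hypothesis K0 : forall x, 0 <= K x.
Hypothesis K1 : \sum_x K x = 1.

Let pK (h : seq nat) (k : nat) : R := if (k < #|X|)%N then K (nth x0 (enum X) k) else 0.

Let pK0 h k : 0 <= pK h k.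
Proof. by rewrite /pK; case: ifP. Qed.

Let pK1 h : series (pK h) @ \oo --> (1 : R).
Proof.
apply/cvgrPdist_lt => e e0; exists #|X| => // n /= qn.
rewrite seriesEnat /= (big_cat_nat (n := #|X|)) //=.
rewrite [X in _ - (_ + X)]big_nat [X in _ - (_ + X)]big1 ?addr0; last first.
  by move=> i /andP[qi _]; rewrite /pK ltnNge qi.
rewrite big_nat (eq_bigr (fun k => K (nth x0 (enum X) k))); last first.
  by move=> i /andP[_ h']; rewrite /pK h'.
rewrite -big_nat cardE -(big_nth x0 xpredT) big_enum /= K1.
by rewrite subrr normr0.
Qed.

(** Inverse transform sampling of the law K with a uniform variable u. *)
Definition sample (u : R) : X := nth x0 (enum X) (draw pK u 0).

Lemma sampleP x : measurable ([set u | sample u = x] : set (measurableTypeR R)) /\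
  unif01 [set u | sample u = x] = (K x)%:E.
Proof.
have X0 : (0 < #|X|)%N by apply/card_gt0P; exists x0.
have E : [set u | sample u = x] = [set u | draw pK u 0 = index x (enum X)].
  apply/seteqP; split => u /=; rewrite /sample; last first.
    by move=> ->; rewrite nth_index // mem_enum.
  move=> <-; rewrite index_uniq ?enum_uniq // -cardE.
  case: (ltnP (draw pK u 0) #|X|) => // h.
  have d0 : draw pK u 0 = 0%N.
    by apply: (draw_supp pK0 pK1); rewrite /pK ltnNge h.
  by move: h; rewrite d0 leqNgt X0.
rewrite E; split.
  exact: (measurable_hist pK0 pK1 1 [set h | head 0%N h = index x (enum X)]).
have H h : setT h -> size h = 0%N -> pK h (index x (enum X)) = K x.
  move=> _ _; rewrite /pK cardE index_mem mem_enum /=.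
  by rewrite nth_index // mem_enum.
have := draw_cond pK0 pK1 H.
rewrite [X in (_ * unif01 X)%E](_ : _ = setT) ?probability_setT ?mule1; last first.
  by apply/seteqP; split.
by move=> <-; congr (unif01 _); apply/seteqP; split => u /= [] //.
Qed.

End Sample.

Section FiniteCoupling.
Context {R : realType} (I X : finType) (p : I -> R) (mu : X -> R) (m : I -> X -> R).
Hypotheses (m0 : forall i x, 0 <= m i x).
Hypotheses (p1 : \sum_i p i = 1) (mu1 : \sum_x mu x = 1).
Hypothesis mrow : forall i, \sum_x m i x <= p i.
Hypothesis mcol : forall x, \sum_i m i x <= mu x.

(** A table of masses whose rows and columns do not exceed the prescribed marginals
    extends to a coupling: distribute what is left independently.  If nothing
    is left, the correction term is 0 / 0 = 0, as it should be. *)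
Lemma finite_coupling : exists J : I -> X -> R,
  [/\ forall i x, m i x <= J i x, forall i, \sum_x J i x = p i
    & forall x, \sum_i J i x = mu x].
Proof.
pose row i := \sum_x m i x; pose col x := \sum_i m i x.
pose tot := \sum_i row i.
have totE : tot = \sum_x col x by rewrite /tot /row exchange_big.
have tot1 : tot <= 1 by rewrite -p1; apply: ler_sum => i _; exact: mrow.
have sp : \sum_i (p i - row i) = 1 - tot by rewrite big_split /= sumrN p1.
have smu : \sum_x (mu x - col x) = 1 - tot by rewrite big_split /= sumrN mu1 totE.
have H (T : finType) (f g : T -> R) : (forall i, g i <= f i) ->
    \sum_i (f i - g i) = 1 - tot ->
    forall i, (f i - g i) * ((1 - tot) / (1 - tot)) = f i - g i.
  move=> fg sfg i; have [e|ne] := eqVneq (1 - tot) 0; last by rewrite divff // mulr1.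
  have -> : f i - g i = 0; last by rewrite mul0r.
  move: sfg; rewrite e => /eqP; rewrite psumr_eq0; last first.
    by move=> j _; rewrite subr_ge0.
  by move=> /allP/(_ i (mem_index_enum i))/=/eqP.
exists (fun i x => m i x + (p i - row i) * (mu x - col x) / (1 - tot)); split.
- move=> i x; rewrite lerDl !mulr_ge0 ?invr_ge0 ?subr_ge0 //; [exact: mrow|exact: mcol].
- move=> i; rewrite big_split /= -mulr_suml -mulr_sumr smu -mulrA.
  by rewrite (H _ p row) // addrC subrK.
- move=> x; rewrite big_split /= -mulr_suml -mulr_suml sp.
  rewrite [X in _ + X](_ : _ = (mu x - col x) * ((1 - tot) / (1 - tot))).
    by rewrite (H _ mu col) // addrC subrK.
  by rewrite mulrAC mulrC mulrA.
Qed.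

End FiniteCoupling.

Section Lift.
Context {R : realType} {d : measure_display} {Omega : measurableType d}.
Variable Pr : probability Omega R.
Variables (I X : finType) (x0 : X) (kappa : Omega -> I) (J : I -> X -> R).
Hypothesis mk : forall i, measurable [set w | kappa w = i].
Hypothesis J0 : forall i x, 0 <= J i x.
Hypothesis Jp : forall i, Pr [set w | kappa w = i] = (\sum_x J i x)%:E.

Local Notation PP := (Pr \x (unif01 (R := R)))%E.

(** The second variable is drawn with an independent uniform variable, with
    conditional law J i / p i; classes of probability 0 use an arbitrary law. *)
Lemma coupling_lift : exists Y : Omega * measurableTypeR R -> X,
  forall i x, measurable [set w | kappa w.1 = i /\ Y w = x] /\
    PP [set w | kappa w.1 = i /\ Y w = x] = (J i x)%:E.
Proof.
pose p i := \sum_x J i x.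
pose K i x := if p i == 0 then (x == x0)%:R else J i x / p i.
have p0 i : 0 <= p i by rewrite sumr_ge0.
have K0 i x : 0 <= K i x by rewrite /K; case: ifP => // _; rewrite divr_ge0.
have K1 i : \sum_x K i x = 1.
  rewrite /K; case: eqP => [_|/eqP h].
    by rewrite (bigD1 x0) //= eqxx big1 ?addr0 // => x /negPf ->.
  by rewrite -mulr_suml divff.
have pK i x : p i * K i x = J i x.
  rewrite /K; case: eqP => [h|/eqP h]; last by rewrite mulrC divfK.
  rewrite h mul0r; move: h => /eqP; rewrite psumr_eq0 // => /allP/(_ x (mem_index_enum x)).
  by move=> /= /eqP ->.
exists (fun w => sample x0 (K (kappa w.1)) w.2) => i x.
have [mS PS] := sampleP x0 (K0 i) (K1 i) x.
rewrite (_ : [set w | _] = [set w | kappa w = i] `*` [set u | sample x0 (K i) u = x]).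
  split; first exact: measurableX.
  by rewrite product_measure1E // -pK EFinM; congr (_ * _)%E; [exact: Jp|exact: PS].
by apply/seteqP; split => -[w u] /= [->].
Qed.

End Lift.

(** * Coupling the ball with the truncated tree *)

Lemma ltree_trunc_code q (t t' : ltree q) r : tree_code r t = tree_code r t' ->
  ltree_trunc t r = ltree_trunc t' r.
Proof.
move=> e; have eV : verts t r = verts t' r := congr1 snd e.
rewrite /ltree_trunc (congr1 fst e : lt_root_label t = lt_root_label t').
congr RLGraph; apply/seteqP; split => w /=.
  by move=> /(mem_verts _ _ _).2; rewrite eV => /mem_verts.
by move=> /(mem_verts _ _ _).2; rewrite -eV => /mem_verts.
Qed.

Section Coupling.
Context {R : realType} (n q : nat) (a b : R) (v : 'I_n) (r : nat) (M c : R).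
Hypotheses (q0 : (0 < q)%N) (a0 : 0 < a) (b0 : 0 < b).
Hypotheses (c0 : 0 <= c) (c1 : c <= 1) (M0 : 0 < M).
Hypothesis Hc : forall t : ltree q, (size (verts t r))%:R <= M ->
  c * tree_pmf a b t r <= \sum_(x | ball_code_event v t r x) sbm_pmf a b x.1 x.2.

Local Notation X := (sgraph n * {ffun 'I_n -> 'I_q})%type.
Let i0 : 'I_q := Ordinal q0.
Let T : R -> ltree q := gw_tree a b i0.
Let gwT : is_gw (unif01 (R := R)) a b T := gw_tree_is_gw i0 a0 b0.
Let mu (x : X) : R := sbm_pmf a b x.1 x.2.
Local Notation Pr := (unif01 (R := R)).

Lemma ball_code_congr (t t' : ltree q) : tree_code r t = tree_code r t' ->
  ball_code_event v t r =1 ball_code_event v t' r.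
Proof. by move=> e x; rewrite /ball_code_event e (ltree_trunc_code e). Qed.

Lemma ball_code_self (t : ltree q) x : ball_code_event v t r x ->
  tree_code r t = tree_code r (ball_tree v x).
Proof. by case/andP => _ /eqP. Qed.

(** The class of a small tree, if it has one: a graph whose ball unfolds to it, the
    same one for all trees with the same code.  Large trees have no class. *)
Definition ball_class (t : ltree q) : option X :=
  if (size (verts t r))%:R <= M then [pick x | ball_code_event v t r x] else None.

Lemma ball_class_congr (t t' : ltree q) :
  tree_code r t = tree_code r t' -> ball_class t = ball_class t'.
Proof.
move=> e; rewrite /ball_class (congr1 snd e : verts t r = verts t' r).
by rewrite (eq_pick (ball_code_congr e)).
Qed.

Lemma ball_class_some (t : ltree q) x0 : ball_class t = Some x0 ->
  (size (verts t r))%:R <= M /\ tree_code r t = tree_code r (ball_tree v x0).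
Proof.
rewrite /ball_class; case: ifP => // tM; case: pickP => // x xt [<-]; split => //.
exact: ball_code_self.
Qed.

Lemma measurable_tree (Q : ltree q -> Prop) :
  (forall t t', tree_code r t = tree_code r t' -> Q t -> Q t') ->
  measurable ([set w | Q (T w)] : set (measurableTypeR R)).
Proof.
move=> HQ; rewrite (_ : [set w | Q (T w)] =
  [set w | [set k | exists2 t, tree_code r t = k & Q t] (tree_code r (T w))]).
  exact: (measurable_code gwT).
apply/seteqP; split => w /=; first by move=> h; exists (T w).
by move=> [t e]; exact: HQ.
Qed.

Let mk i : measurable ([set w | ball_class (T w) = i] : set (measurableTypeR R)).
Proof. by apply: (@measurable_tree (fun t => ball_class t = i)) => t t' /ball_class_congr ->. Qed.

Let p i : R := fine (Pr [set w | ball_class (T w) = i]).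

Let pE i : Pr [set w | ball_class (T w) = i] = (p i)%:E.
Proof. by rewrite fineK // fin_num_measure. Qed.

Let p0 i : 0 <= p i.
Proof. by rewrite -lee_fin -pE. Qed.

Let p1 : \sum_i p i = 1.
Proof.
apply: EFin_inj; rewrite -sumEFin (eq_bigr (fun i => Pr [set w | ball_class (T w) = i])); last first.
  by move=> i _; rewrite pE.
rewrite -probability_bigcup_finType.
- rewrite (_ : \bigcup_i _ = setT) ?probability_setT //.
  by apply/seteqP; split => // w _; exists (ball_class (T w)).
- exact: mk.
- by move=> i j _ _ [w [/= <- <-]].
Qed.

Let A (x0 : X) := ball_code_event v (ball_tree v x0) r.
Let muA x0 : R := \sum_(x | A x0 x) mu x.

Let mu0 x : 0 <= mu x. Proof. exact: sbm_pmf_ge0. Qed.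

Let cp_le x0 : c * p (Some x0) <= muA x0.
Proof.
have [[w0 kw]|ne] := pselect (exists w, ball_class (T w) = Some x0); last first.
  rewrite (_ : p (Some x0) = 0) ?mulr0; first by apply: sumr_ge0.
  rewrite /p (_ : [set w | _] = set0) ?measure0 //.
  by apply/seteqP; split => w //= h; apply: ne; exists w.
have [tM ec] := ball_class_some kw.
apply: (@le_trans _ _ (c * tree_pmf a b (T w0) r)).
  rewrite ler_wpM2l // -lee_fin -pE /tree_pmf -(gw_code_prob gwT).
  apply: le_measure; rewrite ?inE; [exact: mk| |].
    exact: (measurable_code gwT r [set k | k = tree_code r (T w0)]).
  by move=> w /ball_class_some[_ e]; exact: etrans e (esym ec).
apply: le_trans (Hc tM) _; rewrite /muA (eq_bigl (A x0)) //.
exact: ball_code_congr.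
Qed.

Let m (i : option X) x : R :=
  if i is Some x0 then if A x0 x then c * p i / muA x0 * mu x else 0 else 0.

Let muA0 x0 : 0 <= muA x0.
Proof. by apply: sumr_ge0. Qed.

Let m0 i x : 0 <= m i x.
Proof.
rewrite /m; case: i => [x0|] //; case: ifP => // _.
apply: mulr_ge0; last exact: mu0.
by apply: mulr_ge0; [exact: mulr_ge0 c0 (p0 _)|rewrite invr_ge0; exact: muA0].
Qed.

Let mrowS x0 : \sum_x m (Some x0) x = c * p (Some x0).
Proof.
rewrite /m -big_mkcond /= -mulr_sumr -/(muA x0).
have [e|ne] := eqVneq (muA x0) 0; last by rewrite divfK.
rewrite e mulr0; apply/esym/eqP; rewrite eq_le -{1}e cp_le /=.
by rewrite mulr_ge0 ?p0.
Qed.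

Let mrow i : \sum_x m i x <= p i.
Proof.
case: i => [x0|]; first by rewrite mrowS ler_piMl ?p0.
by rewrite big1 ?p0.
Qed.

Let mcol x : \sum_i m i x <= mu x.
Proof.
rewrite (bigD1 (ball_class (ball_tree v x))) //= [X in _ + X]big1 ?addr0.
  rewrite /m; case: (ball_class _) => // x0; case: ifP => // _.
  rewrite ler_piMl ?mu0 //; have [e|ne] := eqVneq (muA x0) 0.
    by rewrite e invr0 mulr0.
  by rewrite ler_pdivrMr ?mul1r ?cp_le // lt_neqAle eq_sym ne muA0.
move=> [x0|] // ne /=; case: ifP => // Ax.
have [[w kw]|nw] := pselect (exists w, ball_class (T w) = Some x0); last first.
  rewrite (_ : p (Some x0) = 0) ?mulr0 ?mul0r //.
  rewrite /p (_ : [set w | _] = set0) ?measure0 //.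
  by apply/seteqP; split => w //= h; apply: nw; exists w.
have [_ ec] := ball_class_some kw; move: ne; rewrite -kw eq_sym.
by rewrite (@ball_class_congr _ (ball_tree v x)) ?eqxx // ec (ball_code_self Ax).
Qed.

Lemma empty_graph_simple : simple_rel ([ffun=> false] : {ffun 'I_n * 'I_n -> bool}).
Proof.
apply/andP; split; first by apply/forallP => i; rewrite ffunE.
by apply/forallP => i; apply/forallP => j; rewrite !ffunE.
Qed.

Let x_def : X := (Sub _ empty_graph_simple, [ffun=> i0]).

Lemma prob_fst (B : set (measurableTypeR R)) : measurable B ->
  measurable [set w : measurableTypeR R * measurableTypeR R | B w.1] /\
  (Pr \x Pr)%E [set w | B w.1] = Pr B.
Proof.
move=> mB; rewrite (_ : [set w | _] = B `*` setT); last first.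
  by apply/seteqP; split => -[w u] //= [].
split; first exact: measurableX.
by rewrite product_measure1E // -[RHS]mule1; congr (_ * _)%E; exact: probability_setT.
Qed.

(** The table m gives to a class x0 and a graph x of that class the mass of the
    tree, reduced by the factor c and spread over the graphs of the class
    proportionally to their probabilities.  Its columns are bounded by the
    likelihood comparison and its total mass is c times the probability that the
    tree has a class. *)
Lemma ball_tree_coupling : exists C : sbm_gw_coupling n q a b,
  ((c * (1 - (\sum_(j < r.+1) (a + b) ^+ j) / M))%:E
     <= cpl_prob C (ball_eq_tree C v r) <= 1)%E.
Proof.
have mu1 : \sum_x mu x = 1 := sbm_pmf_sum n a b q0.
have [J [Jm Jrow Jcol]] := finite_coupling p1 mu1 mrow mcol.
have J0 i x : 0 <= J i x by exact: le_trans (m0 i x) (Jm i x).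
have Jp i : Pr [set w | ball_class (T w) = i] = (\sum_x J i x)%:E by rewrite pE Jrow.
have [Y HY] := coupling_lift x_def mk J0 Jp.
pose PP := (Pr \x Pr)%E : probability _ R.
pose E i x := [set w : measurableTypeR R * measurableTypeR R | ball_class (T w.1) = i /\ Y w = x].
have mE i x : measurable (E i x) by case: (HY i x).
have PE i x : PP (E i x) = (J i x)%:E by case: (HY i x).
have YE x : [set w | Y w = x] = \bigcup_i E i x.
  apply/seteqP; split => w /=; first by move=> h; exists (ball_class (T w.1)).
  by move=> [i _ []].
have mY x : measurable [set w | Y w = x].
  by rewrite YE; apply: measurable_bigcup_countType => i.
have sbmY : is_sbm PP a b (fun w => (Y w).1) (fun w => (Y w).2).
  move=> g s.
  have -> : [set w | (Y w).1 = g /\ (Y w).2 = s] = [set w | Y w = (g, s)].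
    by apply/seteqP; split => w /=; [case: (Y w) => ? ? /= [-> ->]|move=> ->].
  split => //; rewrite YE probability_bigcup_finType //.
    rewrite -[sbm_pmf _ _ _ _]/(mu (g, s)) -Jcol -sumEFin.
    by apply: eq_bigr => i _; exact: PE.
  by move=> i j _ _ [w [/= [<- _] [<- _]]].
have gwY : is_gw PP a b (fun w => T w.1).
  case: gwT => h1 h2 h3; split.
  - by move=> s; case: (prob_fst (h1 s)).
  - by move=> u i k; case: (prob_fst (h2 u i k)).
  move=> s F k uF; rewrite -(h3 s F k uF).
  have mB : measurable ([set x | lt_root_label (T x) = s /\
      forall u i, (u, i) \in F -> lt_offspring (T x) u i = k u i] : set (measurableTypeR R)).
    have := measurable_gw_event gwT s [::] F k; congr (measurable _).
    apply/seteqP; split => w /=.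
      by move=> [h _ h']; split => // u i ui; exact: (h' (u, i)).
    by move=> [h h']; split => // -[u i] ui; exact: h'.
  by case: (prob_fst mB).
exists (SbmGwCoupling sbmY gwY).
rewrite /ball_eq_tree /=.
set B := [set x | _].
have mB : measurable B.
  rewrite (_ : B = \bigcup_x ([set w | Y w = x] `&` [set w |
     [set w' | rl_isom (sg_ball x.1 x.2 v r) (ltree_trunc (T w') r)] w.1])).
    apply: measurable_bigcup_countType => x; apply: measurableI => //.
    apply: (prob_fst _).1; apply: (@measurable_tree (fun t =>
      rl_isom (sg_ball x.1 x.2 v r) (ltree_trunc t r))).
    by move=> t t' /ltree_trunc_code ->.
  apply/seteqP; split => w /=; first by move=> h; exists (Y w).
  by move=> [x _ [<-]].
apply/andP; split; last exact: (@probability_le1 _ _ _ PP).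
have [c00|cpos] := eqVneq c 0; first by rewrite c00 mul0r; exact: measure_ge0.
have cgt : 0 < c by rewrite lt_neqAle eq_sym cpos.
pose F (ix : option X * X) :=
  if ix.1 is Some x0 then if A x0 ix.2 then E ix.1 ix.2 else set0 else set0.
have mF ix : measurable (F ix).
  by case: ix => [[x0|] x]; rewrite /F //=; case: ifP.
have FB : \bigcup_ix F ix `<=` B.
  move=> w [[[x0|] x] _] //; rewrite /F /=; case: ifP => // Ax [/ball_class_some[_ e] Yx].
  rewrite /B /= Yx (ltree_trunc_code e); by case/andP: Ax => /asboolP.
apply: (@le_trans _ _ (PP (\bigcup_ix F ix))); last first.
  by apply: le_measure => //; rewrite inE //; apply: measurable_bigcup_countType.
rewrite probability_bigcup_finType //; last first.
  move=> [i x] [j y] _ _ [w []]; rewrite /F /=.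
  case: i => // i'; case: j => // j'; case: ifP => // _; case: ifP => // _.
  by move=> [<- <-] [<- <-].
have pN : p None <= (\sum_(j < r.+1) (a + b) ^+ j) / M.
  rewrite -lee_fin -pE; apply: le_trans (size_verts_tail gwT a0 b0 q0 r M0).
  apply: le_measure; rewrite ?inE; [exact: mk| |].
    exact: (measurable_code gwT r [set k : 'I_q * seq (word q) | M < (size k.2)%:R]).
  move=> w /=; rewrite /ball_class; case: ifP => [tM|/negbT]; last by rewrite -ltNge.
  case: pickP => // none _; exfalso.
  have := Hc tM; rewrite big_pred0 // leNgt => /negP; apply; rewrite mulr_gt0 //.
  rewrite /tree_pmf mulr_gt0 ?invr_gt0 ?ltr0n //; apply: prodr_gt0 => k _.
  have rk := offspring_rate_gt0 (word_label (lt_root_label (T w)) k.1) k.2 a0 b0.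
  by rewrite /poisson_pmf rk !mulr_gt0 ?exprn_gt0 ?invr_gt0 ?ltr0n ?fact_gt0 ?expR_gt0.
apply: (@le_trans _ _ (\sum_(ix : option X * X) m ix.1 ix.2)%:E); last first.
  rewrite -sumEFin; apply: lee_sum => -[[x0|] x] _; rewrite /F /= ?measure0 //.
  case: ifP => [Ax|_]; last by rewrite measure0.
  by rewrite [leRHS]PE lee_fin; have := Jm (Some x0) x; rewrite /m Ax.
rewrite lee_fin -(pair_bigA _ m) /=.
rewrite [leRHS](bigD1 None) //= [X in _ <= X + _]big1 // add0r.
rewrite (eq_bigr (fun i => c * p i)); last first.
  by move=> [x0|] // _; exact: mrowS.
rewrite -mulr_sumr ler_wpM2l //.
have -> : \sum_(i | i != None) p i = 1 - p None.
  by rewrite -p1 [in RHS](bigD1 None) //= addrAC subrr add0r.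
by rewrite lerD2l lerN2.
Qed.

End Coupling.

(** * The radius and the limit *)

Section Radius.
Context {R : realType} (a b : R).
Hypotheses (a0 : 0 < a) (b0 : 0 < b) (hab : 1 < 2 * (a + b)).
Local Notation D := (2 * (a + b)).
Local Notation rad n := (ball_radius a b n.+1).

Let D0 : 0 < D. Proof. exact: lt_trans ltr01 hab. Qed.
Let lnD : 0 < ln D. Proof. exact: ln_gt0. Qed.

Let radius_arg_ge0 n : 0 <= 1 / (10 * ln D) * ln n.+1%:R.
Proof.
by rewrite mulr_ge0 ?divr_ge0 ?mulr_ge0 ?(ltW lnD) // ln_ge0 // ler1n.
Qed.

Lemma ball_radius_pow n : (D ^+ rad n) ^+ 10 <= n.+1%:R.
Proof.
have Dr : 0 < (D ^+ rad n) ^+ 10 by rewrite !exprn_gt0.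
rewrite -ler_ln ?posrE ?ltr0n // -exprM lnXn // -[leLHS]mulr_natr natrM mulrC.
have h : (rad n)%:R <= 1 / (10 * ln D) * ln n.+1%:R by rewrite truncn_le.
have l10 : 0 < 10 * ln D by rewrite mulr_gt0.
move: h; rewrite mulrAC ler_pdivlMr // mul1r; apply: le_trans.
by rewrite -mulrA.
Qed.

Lemma ball_radius_cvg : (fun n => rad n) @ \oo --> \oo.
Proof.
apply/cvgnyPge => A.
pose n0 := Num.truncn (expR (A%:R * (10 * ln D))).
exists n0 => // n /= nn; rewrite /ball_radius truncn_ge_nat //.
have l10 : 0 < 10 * ln D by rewrite mulr_gt0.
rewrite mulrAC ler_pdivlMr // mul1r -[leLHS]expRK ler_ln ?posrE ?expR_gt0 ?ltr0n //.
apply: ltW; apply: lt_le_trans (truncnS_gt _) _.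
by rewrite ler_nat ltnS.
Qed.

(** Since (a + b) ^ j = D ^ j / 2 ^ j with D > 1, the largest power of D times a
    geometric series of ratio 1/2 bounds the sum. *)
Lemma geometric_bound r : \sum_(j < r.+1) (a + b) ^+ j <= 2 * D ^+ r.
Proof.
suff : \sum_(j < r.+1) (a + b) ^+ j <= D ^+ r * (2 - (1 / 2) ^+ r).
  move=> h; apply: le_trans h _; rewrite mulrC ler_wpM2r ?exprn_ge0 ?(ltW D0) //.
  by rewrite lerBlDr lerDl exprn_ge0.
elim: r => [|r IH]; first by rewrite big_ord1 !expr0 mul1r; lra.
rewrite big_ord_recr /=.
have -> : (a + b) ^+ r.+1 = D ^+ r.+1 * (1 / 2) ^+ r.+1.
  by rewrite -exprMn; congr (_ ^+ _); field.
have h1 : (1 / 2) ^+ r <= 1 :> R by apply: exprn_ile1; lra.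
have h2 : D ^+ r * (2 - (1 / 2) ^+ r) <= D ^+ r.+1 * (2 - (1 / 2) ^+ r).
  rewrite ler_wpM2r //; first by lra.
  by rewrite exprS ler_peMl ?exprn_ge0 // ltW.
apply: le_trans (lerD IH (lexx _)) _; apply: le_trans (lerD h2 (lexx _)) _.
rewrite -mulrDr ler_wpM2l ?exprn_ge0 ?(ltW D0) // [(1 / 2) ^+ r.+1]exprS.
lra.
Qed.

End Radius.

Theorem lemma9p2 (R : realType) (q : nat) (a b : R) (v : forall n, 'I_n.+1)
    (hq : (3 <= q)%N) (ha : 0 < a) (hb : 0 < b) (hab : 1 < 2 * (a + b)) :
  exists C : forall n, sbm_gw_coupling n.+1 q a b,
    (fun n => cpl_prob (C n) (ball_eq_tree (C n) (v n) (ball_radius a b n.+1)))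
      @ \oo --> 1%E.
Proof.
pose D := 2 * (a + b); pose y n := D ^+ ball_radius a b n.+1.
have D0 : 0 < D by exact: lt_trans ltr01 hab.
have q0 : (0 < q)%N by exact: leq_trans hq.
have y1 n : 1 <= y n by rewrite exprn_ege1 // ltW.
have y0 n : 0 < y n by exact: lt_le_trans ltr01 (y1 n).
pose kappa := 1 + (a + b) + (a + b) ^+ 2.
have k0 : 0 <= kappa by rewrite !addr_ge0 ?exprn_ge0 ?addr_ge0 // ltW.
have step n : exists C : sbm_gw_coupling n.+1 q a b,
    ((1 - (kappa + 2) / y n)%:E
      <= cpl_prob C (ball_eq_tree C (v n) (ball_radius a b n.+1)) <= 1)%E.
  set r := ball_radius a b n.+1.
  (* With n + 1 >= y ^ 10, the size bound y ^ 3 balances the two errors: the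
     square of the size over n + 1 is at most y ^ (- 4), and the mean size 2 y
     over y ^ 3 is 2 / y ^ 2.  Only the order 1 / y is kept. *)
  pose M := y n ^+ 3; pose c := Num.max 0 (1 - kappa / y n).
  have M0 : 0 < M by rewrite exprn_gt0.
  have c0 : 0 <= c by rewrite le_max lexx.
  have c1 : c <= 1.
    by rewrite ge_max ler01 lerBlDr lerDl divr_ge0 // ltW.
  have Hc (t : ltree q) : (size (verts t r))%:R <= M -> c * tree_pmf a b t r <=
      \sum_(x | ball_code_event (v n) t r x) sbm_pmf a b x.1 x.2.
    move=> tM; have t0 := tree_pmf_ge0 a b t r.
    rewrite /c maxr_pMl // ge_max mul0r sumr_ge0 /=; last first.
      by move=> x _; apply: sbm_pmf_ge0.
    apply: le_trans (likelihood (v n) t r q0 ha hb).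
    rewrite ler_wpM2r // lerD2l lerN2 /ball_err -/kappa ler_wpM2l //.
    rewrite ler_pdivrMr ?ltr0n //.
    have h1 : (size (verts t r))%:R ^+ 2 <= M ^+ 2.
      by apply: lerXn2r; rewrite ?nnegrE // ltW.
    apply: le_trans h1 _.
    apply: (@le_trans _ _ ((y n)^-1 * y n ^+ 10)); last first.
      by rewrite ler_wpM2l ?invr_ge0 ?(ltW (y0 n)) //; exact: ball_radius_pow.
    rewrite [y n ^+ 10]exprS mulKf ?gt_eqF // /M -exprM.
    by apply: ler_weXn2l.
  have [C /andP[C1 C2]] := ball_tree_coupling q0 ha hb c0 c1 M0 Hc.
  exists C; rewrite C2 andbT; apply: le_trans C1; rewrite lee_fin.
  set s := \sum_(j < r.+1) _.
  have s0 : 0 <= s by apply: sumr_ge0 => j _; rewrite exprn_ge0 // addr_ge0 // ltW.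
  have sM : s / M <= 2 / y n.
    have := geometric_bound hab r; rewrite -/s -/D => sB.
    rewrite ler_pdivrMr // /M exprS mulrA divfK ?gt_eqF //.
    apply: le_trans sB _; rewrite -/(y n) ler_wpM2l // expr2 ler_peMl //.
    exact: ltW.
  have cl : 1 - kappa / y n <= c by rewrite le_max lexx orbT.
  have sM0 : 0 <= s / M by rewrite divr_ge0 // ltW.
  have cs : c * (s / M) <= s / M by rewrite ler_piMl.
  rewrite mulrBr mulr1 mulrDl; lra.
exists (fun n => sval (cid (step n))).
apply: (@squeeze_cvge _ _ _ _ (fun n => (1 - (kappa + 2) / y n)%:E) _ (fun=> 1%E)).
- by apply: nearW => n; exact: (svalP (cid (step n))).
- apply: cvg_EFin; first by apply: nearW.
  rewrite -[X in _ --> X]subr0; apply: cvgB; first exact: cvg_cst.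
  rewrite -[X in _ --> X](mulr0 (kappa + 2)); apply: cvgM; first exact: cvg_cst.
  rewrite (_ : (fun n => (y n)^-1) = (GRing.exp D^-1) \o (fun n => ball_radius a b n.+1)).
    apply: cvg_comp; first exact: ball_radius_cvg.
    apply: cvg_expr; rewrite ger0_norm ?invr_ge0 ?(ltW D0) //.
    by rewrite invf_lt1.
  by apply/funext => n; rewrite /y /= exprVn.
- exact: cvg_cst.
Qed.
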